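(* There exists an integer $M\geq 2$ such that for every integer $N\geq 2$ and every digit set $\mathcal{D}\subset\{0,1,\ldots,N-1\}^2$ with $1<|\mathcal{D}|<N^2$ for which the generalized Sierpiński carpet $F=F(N,\mathcal{D})$ is connected and non-fragile, the following holds: $F$ has cut points if and only if $\chi(\Gamma_M)\geq|\mathcal{D}|^{M-1}$, where $\Gamma_M=\Gamma_M(N,\mathcal{D})$ is the $M$-th Hata graph of $F$.
   Context: Let $N\geq 2$ and $\mathcal{D}\subset\{0,1,\ldots,N-1\}^2$ with $1<|\mathcal{D}|<N^2$. For $i\in\mathcal{D}$ let $\varphi_i(x)=\frac1N(x+i)$, $x\in\mathbb{R}^2$. The generalized Sierpiński carpet (GSC) $F=F(N,\mathcal{D})$ is the unique non-empty compact set with $F=\bigcup_{i\in\mathcal{D}}\varphi_i(F)$. For a word $\bm i=i_1\cdots i_n\in\mathcal{D}^n$ put $\varphi_{\bm i}=\varphi_{i_1}\circ\cdots\circ\varphi_{i_n}$. A point $x$ of a connected topological space $X$ is a cut point of $X$ if $X\setminus\{x\}$ is disconnected. A connected GSC $F$ is called fragile if there is a decomposition $\mathcal{D}=\mathcal{D}_1\cup\mathcal{D}_2$ with $\mathcal{D}_1\cap\mathcal{D}_2=\varnothing$ such that $\big(\bigcup_{i\in\mathcal{D}_1}\varphi_i(F)\big)\cap\big(\bigcup_{i\in\mathcal{D}_2}\varphi_i(F)\big)$ is a singleton; otherwise it is non-fragile. The $n$-th Hata graph $\Gamma_n=\Gamma_n(N,\mathcal{D})$ has vertex set $\mathcal{D}^n$,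 with an edge joining distinct $\bm i,\bm j\in\mathcal{D}^n$ if and only if $\varphi_{\bm i}(F)\cap\varphi_{\bm j}(F)\neq\varnothing$. For a graph $G$ and a vertex $v$, $G-\{v\}$ is the graph obtained by deleting $v$ and all edges incident with $v$; $v$ is a cut vertex of $G$ if $G-\{v\}$ is disconnected. For a connected graph $G$ and a cut vertex $v$, let $G_1(v),\ldots,G_m(v)$ be the connected components of $G-\{v\}$ ordered so that $|G_1(v)|\geq|G_2(v)|\geq\cdots\geq|G_m(v)|$, where $|G_i(v)|$ is the number of vertices. Define $\chi(G)=\max\{|G_2(v)|: v\text{ is a cut vertex of }G\}$ if $G$ has cut vertices, and $\chi(G)=0$ otherwise. *)

(* Defs.v *)
From HB Require Import structures.
From mathcomp Require Import all_boot all_order all_algebra.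
From mathcomp Require Import all_classical all_reals all_analysis.

Set Implicit Arguments.
Unset Strict Implicit.
Unset Printing Implicit Defensive.

Import Order.TTheory GRing.Theory Num.Theory.
Import numFieldNormedType.Exports.

Local Open Scope classical_set_scope.
Local Open Scope ring_scope.

(** * Generalized Sierpinski carpets *)

Definition phi (R : realType) (N : nat) (i : 'I_N * 'I_N) (x : R * R) : R * R :=
  N%:R^-1 *: (x + ((i.1 : nat)%:R, (i.2 : nat)%:R)).

Definition cells (R : realType) (N : nat) (D : {set 'I_N * 'I_N})
    (F : set (R * R)) : set (R * R) :=
  \bigcup_(i in [set` D]) (phi i @` F).

(** The carpet F(N, D) is the unique set satisfying this predicate as soon as
    N >= 2 and D is nonempty. *)
Definition is_GSC (R : realType) (N : nat) (D : {set 'I_N * 'I_N})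
    (F : set (R * R)) : Prop :=
  [/\ F !=set0, compact F & F = cells D F].

Definition cut_point (T : topologicalType) (X : set T) (x : T) : Prop :=
  X x /\ ~ connected (X `\ x).

Definition fragile (R : realType) (N : nat) (D : {set 'I_N * 'I_N})
    (F : set (R * R)) : Prop :=
  exists D1 D2 : {set 'I_N * 'I_N},
    [/\ D = (D1 :|: D2)%SET, (D1 :&: D2)%SET = finset.set0 &
        exists p : R * R, cells D1 F `&` cells D2 F = [set p]].

(** * Cut vertices of finite graphs

    A graph is given by a symmetric irreflexive adjacency relation on its
    finite type of vertices. *)

(** The adjacency relation of G - {v}; the vertex v becomes isolated, and is
    left out of the vertex set in [del_components]. *)
Definition del_vertex (V : finType) (e : rel V) (v : V) : rel V :=
  [rel x y | [&& x != v, y != v & e x y]].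

Definition del_components (V : finType) (e : rel V) (v : V) : {set {set V}} :=
  equivalence_partition (connect (del_vertex e v)) (~: [set v])%SET.

Definition cut_vertex (V : finType) (e : rel V) (v : V) : bool :=
  [exists x, exists y,
    [&& x != v, y != v & ~~ connect (del_vertex e v) x y]].

Definition component_sizes (V : finType) (e : rel V) (v : V) : seq nat :=
  sort geq [seq #|C : {set V}| | C <- enum (del_components e v)].

(** [component_sizes] is indexed from 0, so index 1 is |G_2(v)|; the maximum
    over an empty range is 0. *)
Definition chi (V : finType) (e : rel V) : nat :=
  \max_(v | cut_vertex e v) nth 0%N (component_sizes e v) 1.

(** * Hata graphs *)

Definition word (N : nat) (D : {set 'I_N * 'I_N}) (n : nat) : finType :=
  n.-tuple {i : 'I_N * 'I_N | i \in D}.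

Definition phi_word (R : realType) (N : nat) (D : {set 'I_N * 'I_N}) (n : nat)
    (w : word D n) : R * R -> R * R :=
  foldr (fun i f => phi (val i) \o f) id (w : n.-tuple _).

Definition hata_graph (R : realType) (N : nat) (D : {set 'I_N * 'I_N})
    (F : set (R * R)) (n : nat) : rel (word D n) :=
  [rel w w' | (w != w') &&
    `[< (phi_word w @` F) `&` (phi_word w' @` F) !=set0 >]].

Arguments hata_graph {R N} D F n.

(* Main.v *)
Require Import Defs.
From mathcomp Require Import all_boot all_order all_algebra.
From mathcomp Require Import all_classical all_reals all_analysis.
From mathcomp Require Import zify ring lra.
Import Order.TTheory GRing.Theory Num.Theory.
Import numFieldNormedType.Exports.

Set Implicit Arguments.
Unset Strict Implicit.
Unset Printing Implicit Defensive.

(** If F has a cut point x, non-fragility produces a nested sequence of cells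
    around x that meet both sides of the cut, and blowing up these cells gives
    a sequence of cut points. Whether a coordinate of the point is 0 or 1 is
    preserved by the blow-ups, so that from some stage on the point lies in a
    single cell at every level. If at some stage both sides of the cut contain
    a first-level cell, the word of the point is the required cut vertex of
    every Hata graph. Otherwise the first-level cells off the point all lie on
    one side, which side must change infinitely often, and each change forces
    the contacts of a cell with its neighbours to go through one single subcell.
    An analysis of the self-similar sets of common points of F and F + u at two
    successive changes shows that this makes F fragile.

    Conversely, a cut vertex v of the M-th Hata graph with two large components
    gives a colouring of the cells off v by two disjoint closed sets. For k <= M
    record which colours occur at the eight cells surrounding the k-th prefix of
    v. For M larger than the number of such records, which is independent of N
    and D, two prefixes have the same record; repeating the part of v between
    them for ever yields the word of a cut point of F. *)

(** * Plane maps and the carpet *)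

Lemma pair_ext (T U : Type) (p q : T * U) : p.1 = q.1 -> p.2 = q.2 -> p = q.
Proof. by case: p q => ? ? [? ?] /= -> ->. Qed.

Section Plane.
Local Open Scope classical_set_scope.
Local Open Scope ring_scope.
Variables (R : realType) (N : nat).
Implicit Types (a b : 'I_N * 'I_N) (p q : R * R).

Lemma phi1 a p : (phi a p).1 = N%:R^-1 * (p.1 + (a.1 : nat)%:R).
Proof. by []. Qed.

Lemma phi2 a p : (phi a p).2 = N%:R^-1 * (p.2 + (a.2 : nat)%:R).
Proof. by []. Qed.

Lemma natN_gt0 a : (0 : R) < N%:R.
Proof. by rewrite ltr0n; case: a => [[a aN] _]; exact: leq_ltn_trans aN. Qed.

Lemma phi_inj a : injective (phi a : R * R -> R * R).
Proof.
move=> p q pq; have N0 := lt0r_neq0 (natN_gt0 a).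
by apply: pair_ext; [move/(congr1 fst): pq|move/(congr1 snd): pq];
  rewrite ?phi1 ?phi2 => /(mulfI (invr_neq0 N0)) /addIr.
Qed.

Lemma phi_continuous a : continuous (phi a : R * R -> R * R).
Proof.
move=> p; apply: (@cvgZl_tmp _ _ _ _ _ _ (fun x => x + _)).
apply: (@cvgD _ _ _ _ _ id); first exact: cvg_id.
exact: cvg_cst.
Qed.

Lemma fst_continuous : continuous (fst : R * R -> R).
Proof. by move=> p; exact: cvg_fst. Qed.

Lemma snd_continuous : continuous (snd : R * R -> R).
Proof. by move=> p; exact: cvg_snd. Qed.

Lemma hausdorff_plane : hausdorff_space (R * R)%type.
Proof. exact: norm_hausdorff. Qed.

End Plane.

Section Carpet.
Local Open Scope classical_set_scope.
Local Open Scope ring_scope.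
Variables (R : realType) (N : nat) (D : {set 'I_N * 'I_N}) (F : set (R * R)).
Hypotheses (N2 : (2 <= N)%N) (gsc : is_GSC D F).
Implicit Types (a b : 'I_N * 'I_N) (p q : R * R).

Lemma Ngt1 : (1 : R) < N%:R.
Proof. by rewrite ltr1n. Qed.

Lemma F_compact : compact F. Proof. by case: gsc. Qed.

Lemma F_closed : closed F.
Proof. exact: compact_closed (@hausdorff_plane R) F_compact. Qed.

Lemma F_cover p : F p -> exists a q, [/\ a \in D, F q & p = phi a q].
Proof.
case: gsc => _ _ FE; rewrite {1}FE => -[a aD [q Fq <-]].
by exists a, q.
Qed.

Lemma F_phi a q : a \in D -> F q -> F (phi a q).
Proof. by case: gsc => _ _ FE aD Fq; rewrite FE; exists a => //; exists q. Qed.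

(** Self-similarity at a point of F where [f], one of the coordinates, is extremal: N times the
    extreme value is a digit plus another value of [f] on F, and digits lie between 0 and N - 1. *)
Lemma F_coord_bounds (f : R * R -> R) (d : 'I_N * 'I_N -> 'I_N) :
    continuous f ->
    (forall a p, f (phi a p) = N%:R^-1 * (f p + (d a : nat)%:R)) ->
  forall p, F p -> 0 <= f p <= 1.
Proof.
move=> cf fphi p Fp; have N1 := Ngt1.
have F0 : F !=set0 by exists p.
have cfF : {within F, continuous f} by exact: continuous_subspaceT.
have N0 : (N%:R : R) != 0 by rewrite gt_eqF// (lt_trans ltr01).
have eqN (u v : R) : u = N%:R^-1 * v -> N%:R * u = v by move=> ->; rewrite mulVKf.
have lo (x y e n : R) : 1 < n -> 0 <= e -> n * x = y + e -> x <= y -> 0 <= x.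
  by move=> *; nra.
have hi (x y e n : R) : 1 < n -> e + 1 <= n -> n * x = y + e -> y <= x -> x <= 1.
  by move=> *; nra.
apply/andP; split.
  have [c /[!inE] Fc cmin] := compact_EVT_min F0 F_compact cfF.
  apply: le_trans (cmin p (mem_set Fp)).
  have [a [q [aD Fq cE]]] := F_cover Fc.
  have /eqN cq := etrans (congr1 f cE) (fphi a q).
  exact: lo N1 (ler0n _ _) cq (cmin q (mem_set Fq)).
have [c /[!inE] Fc cmax] := compact_EVT_max F0 F_compact cfF.
apply: le_trans (cmax p (mem_set Fp)) _.
have [a [q [aD Fq cE]]] := F_cover Fc.
have /eqN cq := etrans (congr1 f cE) (fphi a q).
apply: hi N1 _ cq (cmax q (mem_set Fq)).
by rewrite natr1 ler_nat.
Qed.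

Lemma F_bounds p : F p -> (0 <= p.1 <= 1) && (0 <= p.2 <= 1).
Proof.
move=> Fp; apply/andP; split.
  exact: (F_coord_bounds (@fst_continuous R) (d := fst)).
exact: (F_coord_bounds (@snd_continuous R) (d := snd)).
Qed.

End Carpet.

(** * Contact sets *)

Section Contact.
Local Open Scope classical_set_scope.
Local Open Scope ring_scope.
Variables (R : realType) (N : nat) (D : {set 'I_N * 'I_N}) (F : set (R * R)).
Hypotheses (N2 : (2 <= N)%N) (gsc : is_GSC D F).
Implicit Types (a b j k : 'I_N * 'I_N) (p q : R * R) (u v w : int * int).

Lemma geometric_eq0 (x : R) : (forall n, `|x| * N%:R ^+ n <= 1) -> x = 0.
Proof.
move=> xN; apply/eqP; rewrite -normr_eq0 eq_le normr_ge0 andbT leNgt.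
apply/negP => x0; have := archi_boundP (ltW x0).
set n := Num.bound _; have := xN (Num.bound `|x|^-1).
rewrite -ler_pdivlMl// mulr1 => xn _.
have := archi_boundP (_ : 0 <= `|x|^-1); rewrite invr_ge0 normr_ge0 => /(_ isT).
move=> /(le_lt_trans xn); rewrite -natrX ltr_nat.
by rewrite ltnNge (ltnW (ltn_expl _ N2)).
Qed.

Definition unshift u p : R * R := (p.1 - u.1%:~R, p.2 - u.2%:~R).

(** The set F ∩ (F + u). For u = b - a, [phi a] maps it onto the common points of the cells a and
    b. *)
Definition contact u : set (R * R) := [set p | F p /\ F (unshift u p)].

(** For two cells meeting at [phi a q], at relative position [u], the relative
    position of the subcells [a] and [b]. *)
Definition subpos u a b : int * int :=
  ((b.1 : nat)%:Z - (a.1 : nat)%:Z + N%:Z * u.1,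
   (b.2 : nat)%:Z - (a.2 : nat)%:Z + N%:Z * u.2).

Lemma Nneq0 : (N%:R : R) != 0.
Proof. by rewrite pnatr_eq0 -lt0n (ltnW N2). Qed.

Lemma unshift_phi u a b q : unshift u (phi a q) = phi b (unshift (subpos u a b) q).
Proof.
have N0 := Nneq0.
apply: pair_ext; [change ((phi a q).1 - u.1%:~R = (phi b (unshift (subpos u a b) q)).1)
  |change ((phi a q).2 - u.2%:~R = (phi b (unshift (subpos u a b) q)).2)];
  by rewrite ?phi1 ?phi2 /unshift /subpos /= !rmorphD !rmorphN rmorphM /= -!pmulrn; field.
Qed.

Lemma contact_phi u a b q : a \in D -> b \in D ->
  contact (subpos u a b) q -> contact u (phi a q).
Proof.
move=> aD bD [Fq Fs]; split; first exact: (F_phi gsc).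
by rewrite (unshift_phi _ _ b); exact: (F_phi gsc).
Qed.

(** With [contact_phi], this makes the contact sets a graph-directed self-similar system:
    [contact u] is the union of the images under [phi a] of the sets [contact (subpos u a b)]. *)
Lemma contact_unfold u p : contact u p ->
  exists a b q, [/\ a \in D, b \in D, p = phi a q & contact (subpos u a b) q].
Proof.
move=> [/(F_cover gsc)[a [q [aD Fq ->]]] /(F_cover gsc)[b [r [bD Fr sE]]]].
exists a, b, q; split => //; split => //.
by move: sE; rewrite (unshift_phi _ _ b) => /phi_inj ->.
Qed.

Lemma contact_box u p : contact u p -> [/\ -1 <= u.1, u.1 <= 1, -1 <= u.2 & u.2 <= 1].
Proof.
move=> [/(F_bounds N2 gsc) /andP[/andP[p1 p1'] /andP[p2 p2']]].
move=> /(F_bounds N2 gsc) /andP[/andP[/= q1 q1'] /andP[q2 q2']].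
by split; rewrite -(ler_int R) ?rmorphN1; lra.
Qed.

(** Both coordinates of u are 1 or -1, and the unit squares containing F and F + u share only a
    corner. *)
Lemma contact_diag u p q : u.1 != 0 -> u.2 != 0 ->
  contact u p -> contact u q -> p = q.
Proof.
move=> u1 u2 cp cq; have [? ? ? ?] := contact_box cp.
have E1 : u.1 = 1 \/ u.1 = -1 by lia.
have E2 : u.2 = 1 \/ u.2 = -1 by lia.
move: cp => [/(F_bounds N2 gsc) /andP[/andP[p1 p1'] /andP[p2 p2']]].
move=> /(F_bounds N2 gsc) /andP[/andP[/= r1 r1'] /andP[r2 r2']].
move: cq => [/(F_bounds N2 gsc) /andP[/andP[q1 q1'] /andP[q2 q2']]].
move=> /(F_bounds N2 gsc) /andP[/andP[/= s1 s1'] /andP[s2 s2']].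
by apply: pair_ext; [move: r1 r1' s1 s1'; case: E1 => ->|
  move: r2 r2' s2 s2'; case: E2 => ->]; rewrite ?rmorphN1 ?rmorph1; lra.
Qed.

Lemma contact_opp u p : contact u p -> contact (- u) (unshift u p).
Proof.
move=> [Fp Fs]; split => //; suff -> : unshift (- u) (unshift u p) = p by [].
by apply: pair_ext; rewrite /= rmorphN /= opprK subrK.
Qed.

(** Every contact with the copy of F at position u goes through the first-level cell j, and no other
    first-level cell takes part in it. *)
Definition exclusive u j :=
  forall a p, a \in D -> F p -> contact u (phi a p) -> a = j.

Definition edge u : bool := `|u.1| + `|u.2| == 1.

(** The bound of [contact_box] on [subpos u a b] forces a and b to be the corner digits facing each
    other across the common corner. *)
Lemma contact_corner u p : contact u p -> u.1 != 0 -> u.2 != 0 ->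
  exists a b, [/\ a \in D, b \in D & subpos u a b = u].
Proof.
move=> cp u1 u2; have [? ? ? ?] := contact_box cp.
have [a [b [q [aD bD _ /contact_box cq]]]] := contact_unfold cp.
have E1 : u.1 = 1 \/ u.1 = -1 by lia.
have E2 : u.2 = 1 \/ u.2 = -1 by lia.
exists a, b; split => //; move: E1 E2 cq; rewrite /subpos; clear.
have := ltn_ord a.1; have := ltn_ord a.2; have := ltn_ord b.1; have := ltn_ord b.2.
by case: u => u1 u2 /= ? ? ? ? [] -> [] -> [? ? ? ?]; congr pair; lia.
Qed.

(** Pulling back by [phi j] stays in [contact u] and multiplies coordinate differences by N, yet
    these never exceed 1. *)
Lemma self_contact_eq u j p q :
    (forall p, contact u p -> exists2 q, contact u q & p = phi j q) ->
  contact u p -> contact u q -> p = q.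
Proof.
move=> H cp cq; apply/eqP; rewrite -subr_eq0; apply/eqP.
have N0 := Nneq0.
suff E n : forall p q, contact u p -> contact u q ->
    `|p.1 - q.1| * N%:R ^+ n <= 1 /\ `|p.2 - q.2| * N%:R ^+ n <= 1.
  by apply: pair_ext => /=; apply: geometric_eq0 => n;
    have [] := E n _ _ cp cq.
elim: n => [|n IH] {cp cq}p {}q cp cq.
  rewrite expr0 !mulr1.
  have [/(F_bounds N2 gsc) /andP[/andP[? ?] /andP[? ?]] _] := cp.
  have [/(F_bounds N2 gsc) /andP[/andP[? ?] /andP[? ?]] _] := cq.
  by rewrite !ler_norml; split; apply/andP; split; lra.
have [p' cp' ->] := H _ cp; have [q' cq' ->] := H _ cq.
have [] := IH _ _ cp' cq'; rewrite !phi1 !phi2 -!mulrBr !normrM !opprD !exprS.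
rewrite normfV (ger0_norm (ler0n _ _)) => A B.
by split; rewrite mulrACA mulVf// mul1r addrACA subrr addr0.
Qed.

End Contact.

Lemma edgeP (u : int * int) : edge u ->
  [\/ u = (1, 0)%R, u = (-1, 0)%R, u = (0, 1)%R | u = (0, -1)%R].
Proof.
case: u => u1 u2; rewrite /edge /= => /eqP e.
have [[-> ->]|[[-> ->]|[[-> ->]|[-> ->]]]] : (u1 = 1 /\ u2 = 0 \/
  (u1 = -1 /\ u2 = 0 \/ (u1 = 0 /\ u2 = 1 \/ u1 = 0 /\ u2 = -1)))%R by lia.
- by constructor 1. - by constructor 2. - by constructor 3. - by constructor 4.
Qed.

Lemma diagP (u : int * int) : u.1 != 0%R -> u.2 != 0%R ->
  [/\ -1 <= u.1, u.1 <= 1, -1 <= u.2 & u.2 <= 1]%R ->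
  [\/ u = (1, 1)%R, u = (1, -1)%R, u = (-1, 1)%R | u = (-1, -1)%R].
Proof.
case: u => u1 u2 /= n1 n2 [? ? ? ?].
have [[-> ->]|[[-> ->]|[[-> ->]|[-> ->]]]] : (u1 = 1 /\ u2 = 1 \/
  (u1 = 1 /\ u2 = -1 \/ (u1 = -1 /\ u2 = 1 \/ u1 = -1 /\ u2 = -1)))%R by lia.
- by constructor 1. - by constructor 2. - by constructor 3. - by constructor 4.
Qed.

Lemma pair_inj2 (T U : Type) (p q : T * U) : p = q -> p.1 = q.1 /\ p.2 = q.2.
Proof. by move=> ->. Qed.

(** * Contacts of edge neighbours that reproduce themselves *)

Section SelfContact.
Local Open Scope classical_set_scope.
Local Open Scope ring_scope.
Variables (R : realType) (N : nat) (D : {set 'I_N * 'I_N}) (F : set (R * R)).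
Hypotheses (N2 : (2 <= N)%N) (gsc : is_GSC D F).
Implicit Types (a b j k : 'I_N * 'I_N) (p q : R * R) (u v w : int * int).

Lemma exclusive_unfold u j p : exclusive D F u j -> contact F u p ->
  exists b q, [/\ b \in D, p = phi j q & contact F (subpos u j b) q].
Proof.
move=> exj cp; have [a [b [q [aD bD pE cq]]]] := contact_unfold N2 gsc cp.
have aj : a = j.
  by apply: exj (aD) (_ : F q) _; [case: cq|rewrite -pE].
by exists b, q; rewrite -aj.
Qed.

Lemma exclusive_phi u j a b q : exclusive D F u j -> a \in D -> b \in D ->
  contact F (subpos u a b) q -> a = j.
Proof.
move=> exj aD bD cq; apply: exj (aD) (_ : F q) _; first by case: cq.
exact: (contact_phi N2 gsc aD bD cq).
Qed.

(** Otherwise all the points of [contact u] would come from diagonal contacts,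
    in both diagonal directions; then the four corner cells would be in [D],
    and two of them would meet [contact u]. *)
Lemma exclusive_self_contact u j p q : edge u -> exclusive D F u j ->
  contact F u p -> contact F u q -> p <> q ->
  exists2 b, b \in D & subpos u j b = u.
Proof.
move=> eu exj cp cq pq; apply: contrapT => nob.
have [b [p' [bD pE cp']]] := exclusive_unfold exj cp.
have [c [q' [cD qE cq']]] := exclusive_unfold exj cq.
have diag e r : e \in D -> contact F (subpos u j e) r ->
    (subpos u j e).1 != 0 /\ (subpos u j e).2 != 0.
  move=> eD cr; have := contact_box N2 gsc cr.
  have : subpos u j e <> u by move=> E; apply: nob; exists e.
  have := ltn_ord e.1; have := ltn_ord e.2; have := ltn_ord j.1; have := ltn_ord j.2.
  move=> ? ? ? ? E [? ? ? ?].
  have {}E : (subpos u j e).1 <> u.1 \/ (subpos u j e).2 <> u.2.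
    by apply: contrapT => /not_orP[/contrapT ? /contrapT ?]; apply: E; exact: pair_ext.
  by case/edgeP: eu => uE; subst u; simpl in *; lia.
have [d1 d2] := diag _ _ bD cp'; have [e1 e2] := diag _ _ cD cq'.
have [bc|bc] := eqVneq (subpos u j b) (subpos u j c).
  apply: pq; rewrite pE qE; congr phi; apply: (contact_diag N2 gsc d1 d2 cp').
  by rewrite bc.
have Dt := diagP d1 d2 (contact_box N2 gsc cp'); have Dt' := diagP e1 e2 (contact_box N2 gsc cq').
have [a1 [b1 [a1D b1D E1]]] := contact_corner N2 gsc cp' d1 d2.
have [a2 [b2 [a2D b2D E2]]] := contact_corner N2 gsc cq' e1 e2.
have [F1 F2 a12] : [/\ subpos u a1 b2 = u, subpos u a2 b1 = u & a1 <> a2].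
  have dot e r : contact F (subpos u j e) r ->
      (subpos u j e).1 * u.1 + (subpos u j e).2 * u.2 = 1.
    move/(contact_box N2 gsc); have := ltn_ord e.1; have := ltn_ord e.2.
    have := ltn_ord j.1; have := ltn_ord j.2.
    by case/edgeP: eu => -> /= ? ? ? ? [? ? ? ?]; lia.
  move: (dot _ _ cp') (dot _ _ cq') Dt Dt' bc E1 E2; clear d1 d2 e1 e2 cp' cq' dot diag pE qE.
  move: (subpos u j b) (subpos u j c) => t t' T T' Dt Dt' tt'.
  move=> /pair_inj2[H1 H2] /pair_inj2[H3 H4].
  have bd (e : 'I_N * 'I_N) : ((e.1 < N)%N /\ (e.2 < N)%N) by rewrite !ltn_ord.
  have [? ?] := bd a1; have [? ?] := bd a2; have [? ?] := bd b1; have [? ?] := bd b2.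
  have [[G1 G2] [G3 G4] G5] : [/\ (subpos u a1 b2).1 = u.1 /\ (subpos u a1 b2).2 = u.2,
    (subpos u a2 b1).1 = u.1 /\ (subpos u a2 b1).2 = u.2 &
    (a1.1 <> a2.1 :> nat) \/ (a1.2 <> a2.2 :> nat)].
    by case/edgeP: eu T T' H1 H2 H3 H4 => ->; case: Dt tt' => ->; case: Dt' => -> //= ? ? ? ? ? ?;
     split; lia.
  by split; [exact: pair_ext|exact: pair_ext|move=> a12; case: G5; rewrite a12].
apply: a12; rewrite (exclusive_phi exj a1D b2D (q := p)) ?F1//.
by rewrite (exclusive_phi exj a2D b1D (q := p)) ?F2.
Qed.

End SelfContact.

(** * Situations in which exclusive contacts reduce to one point *)

Section ExclusiveCells.
Local Open Scope classical_set_scope.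
Local Open Scope ring_scope.
Variables (R : realType) (N : nat) (D : {set 'I_N * 'I_N}) (F : set (R * R)).
Hypotheses (N2 : (2 <= N)%N) (gsc : is_GSC D F).
Implicit Types (a b j k : 'I_N * 'I_N) (p q : R * R) (u v w : int * int).

Lemma ord_pair_lt a : (a.1 < N)%N /\ (a.2 < N)%N.
Proof. by rewrite !ltn_ord. Qed.

(** Along u the position is forced by the box bound to agree with u, so a position other than u
    differs from it transversally. *)
Lemma subpos_edge u a b q : edge u -> contact F (subpos u a b) q ->
  subpos u a b <> u -> (subpos u a b).1 != 0 /\ (subpos u a b).2 != 0.
Proof.
move=> eu /(contact_box N2 gsc)[? ? ? ?] tu.
have [? ?] := ord_pair_lt a; have [? ?] := ord_pair_lt b.
have {}tu : (subpos u a b).1 <> u.1 \/ (subpos u a b).2 <> u.2.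
  by apply: contrapT => /not_orP[/contrapT ? /contrapT ?]; apply: tu; exact: pair_ext.
by case/edgeP: eu => uE; subst u; simpl in *; lia.
Qed.

Lemma subpos_edge_dot u a b q : edge u -> contact F (subpos u a b) q ->
  (subpos u a b).1 * u.1 + (subpos u a b).2 * u.2 = 1.
Proof.
move=> eu /(contact_box N2 gsc)[? ? ? ?].
have [? ?] := ord_pair_lt a; have [? ?] := ord_pair_lt b.
by case/edgeP: eu => uE; subst u; simpl in *; lia.
Qed.

(** All contact points come from the one pair of subcells j and k. If its position is again u, the
    contact set contracts into itself; otherwise the position is diagonal. *)
Lemma exclusive_opp u j k p q : edge u -> exclusive D F u j ->
  exclusive D F (- u) k -> contact F u p -> contact F u q -> p = q.
Proof.
move=> eu exj exk cp cq.
have unf r : contact F u r -> exists2 r', r = phi j r' & contact F (subpos u j k) r'.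
  move=> cr; have [b [r' [bD rE cr']]] := exclusive_unfold N2 gsc exj cr.
  exists r' => //; rewrite -(exk b (unshift (subpos u j b) r')) //; first by case: cr'.
  by rewrite -(unshift_phi N2) -rE; exact: contact_opp.
have [tu|tu] := eqVneq (subpos u j k) u.
  apply: (self_contact_eq N2 gsc (j := j) _ cp cq) => r /unf[r' rE cr'].
  by exists r' => //; rewrite tu in cr'; exact: cr'.
have [p' -> cp'] := unf _ cp; have [q' -> cq'] := unf _ cq.
have [t1 t2] := subpos_edge eu cp' (elimN eqP tu).
by rewrite (contact_diag N2 gsc t1 t2 cp' cq').
Qed.

(** The digit a is next to j, transversally to u. With two contact points, some pair (j, c) would be
    in contact diagonally, c being next to b. Depending on the side, (a, b) would have the same
    diagonal position or (a, c) the position u, so that a would carry contact points, against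
    exclusivity. *)
Lemma exclusive_side u j a b p q : edge u -> exclusive D F u j ->
  b \in D -> subpos u j b = u ->
  a \in D -> `|a.1%:Z - j.1%:Z| + `|a.2%:Z - j.2%:Z| = 1 ->
  (a.1%:Z - j.1%:Z) * u.1 + (a.2%:Z - j.2%:Z) * u.2 = 0 ->
  contact F u p -> contact F u q -> p = q.
Proof.
move=> eu exj bD bE aD aj1 aju cp cq; apply: contrapT => pq.
have aj : a <> j by move=> E; move: aj1; rewrite E !subrr.
have [r [c [cD cr tu]]] : exists r c, [/\ c \in D, contact F (subpos u j c) r
    & subpos u j c <> u].
  apply: contrapT => nr; apply: pq; apply: (self_contact_eq N2 gsc (j := j) _ cp cq) => r cr.
  have [c [r' [cD rE cr']]] := exclusive_unfold N2 gsc exj cr.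
  have [tu|/eqP tu] := eqVneq (subpos u j c) u.
    by exists r' => //; rewrite -tu.
  by exfalso; apply: nr; exists r', c.
have [t1 t2] := subpos_edge eu cr tu; have dt := subpos_edge_dot eu cr.
have [h h0 h1 h2] := contact_box N2 gsc cr.
have [bE1 bE2] := pair_inj2 bE.
have [E|E] : subpos u a b = subpos u j c \/ subpos u a c = u.
  suff : ((subpos u a b).1 = (subpos u j c).1 /\ (subpos u a b).2 = (subpos u j c).2)
      \/ ((subpos u a c).1 = u.1 /\ (subpos u a c).2 = u.2).
    by case=> -[? ?]; [left|right]; exact: pair_ext.
  by clear - eu aj1 aju t1 t2 dt h h0 h1 h2 bE1 bE2;
     case/edgeP: eu => uE; subst u; simpl in *; lia.
- by apply: aj; apply: (exclusive_phi N2 gsc exj aD bD (q := r)); rewrite E.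
- by apply: aj; apply: (exclusive_phi N2 gsc exj aD cD (q := p)); rewrite E.
Qed.

(** For an edge u, the coordinate of j transverse to u is extreme. A nonempty contact exclusive to j
    already puts j on the side facing u, so j is then a corner digit. *)
Definition corner_along u j : Prop :=
  (u.1 = 0 \/ j.2 = 0%N :> nat \/ j.2.+1 = N) /\
  (u.2 = 0 \/ j.1 = 0%N :> nat \/ j.1.+1 = N).

Lemma edge_or_diag u p : contact F u p -> u != 0 ->
  edge u \/ (u.1 != 0 /\ u.2 != 0).
Proof.
move=> /(contact_box N2 gsc)[? ? ? ?] u0.
have : u.1 <> 0 \/ u.2 <> 0.
  apply: contrapT => /not_orP[/contrapT ? /contrapT ?].
  by move/eqP: u0; apply; exact: pair_ext.
by rewrite /edge; lia.
Qed.

(** For diagonal u, combine [contact_corner] with exclusivity. For an edge, a subcontact in another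
    position is diagonal and brings corner digits into D; the one across the common side faces the
    corner digit j, in position u. *)
Lemma exclusive_corner u j p : exclusive D F u j -> contact F u p ->
  (edge u -> corner_along u j) -> u != 0 ->
  exists2 b, b \in D & subpos u j b = u.
Proof.
move=> exj cp cor u0.
have [eu|[u1 u2]] := edge_or_diag cp u0; last first.
  have [a [b [aD bD abE]]] := contact_corner N2 gsc cp u1 u2.
  by exists b => //; rewrite -{2}abE (exclusive_phi N2 gsc exj aD bD (q := p)) ?abE.
have [b [q [bD _ cq]]] := exclusive_unfold N2 gsc exj cp.
have [tu|/eqP tu] := eqVneq (subpos u j b) u; first by exists b.
have [t1 t2] := subpos_edge eu cq tu; have dt := subpos_edge_dot eu cq.
have [c [d [cD dD cdE]]] := contact_corner N2 gsc cq t1 t2.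
exists d => //; have [c1 c2] := cor eu.
have [h h0] := ord_pair_lt b; have [h1 h2] := ord_pair_lt c.
have [h3 h4] := ord_pair_lt d; have [h5 h6] := ord_pair_lt j.
suff [? ?] : (subpos u j d).1 = u.1 /\ (subpos u j d).2 = u.2 by exact: pair_ext.
case: (diagP t1 t2 (contact_box N2 gsc cq)) => tE; rewrite tE in cdE dt;
  have [T1 T2] := pair_inj2 tE; have [E1 E2] := pair_inj2 cdE;
  clear - c1 c2 eu h h0 h1 h2 h3 h4 h5 h6 dt T1 T2 E1 E2;
  by case/edgeP: eu => uE; subst u; simpl in *; lia.
Qed.

(** The cell j touches the sides of the square towards both u and v. As N is at least 2 these sides
    are not opposite, so v has a transverse component, which makes the transverse coordinate of j
    extreme. *)
Lemma two_exclusive_corner u v j p q : exclusive D F u j -> exclusive D F v j ->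
  u != v -> v != 0 -> contact F u p -> contact F v q -> edge u ->
  corner_along u j.
Proof.
move=> exu exv uv v0 cp cq eu.
have [b [p' [_ _ /(contact_box N2 gsc)[h0 h1 h2 h3]]]] :=
  exclusive_unfold N2 gsc exu cp.
have [c [q' [_ _ /(contact_box N2 gsc)[h4 h5 h6 h7]]]] :=
  exclusive_unfold N2 gsc exv cq.
have {}uv : u.1 <> v.1 \/ u.2 <> v.2.
  by apply: contrapT => /not_orP[/contrapT ? /contrapT ?]; case/eqP: uv; exact: pair_ext.
have {}v0 : v.1 <> 0 \/ v.2 <> 0.
  by apply: contrapT => /not_orP[/contrapT ? /contrapT ?]; case/eqP: v0; exact: pair_ext.
have [k0 k1 k2 k3] := contact_box N2 gsc cq.
have [l0 l1] := ord_pair_lt b; have [l2 l3] := ord_pair_lt c.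
have [l4 l5] := ord_pair_lt j.
have V1 : v.1 = -1 \/ v.1 = 0 \/ v.1 = 1 by lia.
have V2 : v.2 = -1 \/ v.2 = 0 \/ v.2 = 1 by lia.
clear - N2 eu h0 h1 h2 h3 h4 h5 h6 h7 uv v0 l0 l1 l2 l3 l4 l5 V1 V2.
rewrite /corner_along; case: v => v1 v2 in V1 V2 uv v0 h4 h5 h6 h7 *; simpl in *.
by case/edgeP: eu => uE; subst u; simpl in *;
  case: V1 => [?|[?|?]]; case: V2 => [?|[?|?]]; subst; lia.
Qed.

(** Two exclusive contacts through the same cell force that cell to be a
    corner, whose fixed point is then the only contact point. *)
Lemma exclusive_two u v j p q : exclusive D F u j -> exclusive D F v j ->
  u != 0 -> v != 0 -> u != v ->
  (forall p p', contact F u p -> contact F u p' -> p = p') ->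
  (forall p p', contact F v p -> contact F v p' -> p = p') ->
  contact F u p -> contact F v q -> p = q.
Proof.
move=> exu exv u0 v0 uv u1 v1 cp cq.
(* The pair (j, b) being again in position w, [phi j] maps the one-point set [contact w] into
   itself. *)
have fix_j r w : exclusive D F w j -> w != 0 -> (edge w -> corner_along w j) ->
    (forall p p', contact F w p -> contact F w p' -> p = p') ->
    contact F w r -> r = phi j r.
  move=> exw w0 corw w1 cr; have [b bD bE] := exclusive_corner exw cr corw w0.
  have jD : j \in D.
    have [a [c [s [aD _ rE cs]]]] := contact_unfold N2 gsc cr.
    by rewrite -(exw a s) //; [case: cs|rewrite -rE].
  by apply: w1 => //; apply: (contact_phi N2 gsc jD bD); rewrite bE.
have pE : p = phi j p.
  apply: (fix_j _ u) => //.
  exact: (two_exclusive_corner exu exv uv v0 cp cq).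
have qE : q = phi j q.
  apply: (fix_j _ v) => //; rewrite eq_sym in uv.
  exact: (two_exclusive_corner exv exu uv u0 cq cp).
have N1 := Ngt1 R N2.
have fix_eq (x y d : R) : x = N%:R^-1 * (x + d) -> y = N%:R^-1 * (y + d) -> x = y.
  move=> xE yE; have : x - y = N%:R^-1 * (x - y).
    by rewrite {1}xE {1}yE -mulrBr opprD addrACA subrr addr0.
  move/(congr1 (fun z => N%:R * z)); rewrite mulVKf ?(Nneq0 R N2) // => E.
  by nra.
apply: pair_ext.
  by apply: (fix_eq _ _ (j.1 : nat)%:R); rewrite -phi1; congr fst.
by apply: (fix_eq _ _ (j.2 : nat)%:R); rewrite -phi2; congr snd.
Qed.
End ExclusiveCells.

(** * Cut pairs *)

Lemma connected_closed_cover (T : topologicalType) (K P Q : set T) :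
  (connected K -> closed P -> closed Q -> K `<=` P `|` Q ->
  K `&` P `&` Q = set0 -> K `<=` P \/ K `<=` Q)%classic.
Proof.
move=> cK cP cQ KPQ K0.
have [KP0|KP0] := pselect (K `&` P !=set0)%classic; last first.
  by right=> z Kz; have [Pz|//] := KPQ _ Kz; exfalso; apply: KP0; exists z.
left; suff <- : (K `&` P = K)%classic by exact: subIsetr.
apply: cK => //; [exists (~` Q)%classic|by exists P].
  exact: closed_openC.
apply/seteqP; split => z [Kz Pz]; split => //.
  by move=> Qz; have : set0 z by rewrite -K0.
by have [|/Pz] := KPQ _ Kz.
Qed.

Section CutPairs.
Local Open Scope classical_set_scope.
Local Open Scope ring_scope.
Variables (R : realType) (N : nat) (D : {set 'I_N * 'I_N}) (F : set (R * R)).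
Hypotheses (N2 : (2 <= N)%N) (gsc : is_GSC D F) (Fc : connected F).
Implicit Types (a : 'I_N * 'I_N) (p q x : R * R) (P Q : set (R * R)).

(** The two sides of a cut, each completed by the cut point so as to be closed. *)
Definition cut_pair x P Q :=
  [/\ closed P, closed Q, P `|` Q = F, P `&` Q = [set x] &
      (exists p, P p /\ p <> x) /\ (exists q, Q q /\ q <> x)].

Lemma cut_pairC x P Q : cut_pair x P Q -> cut_pair x Q P.
Proof. by move=> [? ? ? ? [? ?]]; split; rewrite 1?setUC 1?setIC. Qed.

Lemma cut_point_pair x : cut_point F x -> exists P Q, cut_pair x P Q.
Proof.
move=> [Fx /connectedPn[E [E0 FE [sE1 sE2]]]].
have clF b : closure (E b) `<=` F.
  rewrite [X in _ `<=` X](closure_id F).1; last exact: F_closed gsc.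
  apply: closureS => z Ebz; suff [] : (F `\ x) z by [].
  by rewrite FE; case: b Ebz; [right|left].
have FEx z : F z -> z <> x -> E false z \/ E true z.
  by move=> Fz zx; have : (F `\ x) z by []; rewrite FE.
have nEx b : ~ E b x.
  move=> Ebx; have [] : (F `\ x) x by rewrite FE; case: b Ebx; [right|left].
  by move=> _; apply.
have ex b : exists p, (closure (E b) `|` [set x]) p /\ p <> x.
  have [p Ep] := E0 b; exists p; split; first by left; exact: subset_closure.
  by move=> px; apply: (nEx b); rewrite -px.
have clx b : closed (closure (E b) `|` [set x]).
  apply: closedU; first exact: closed_closure.
  exact/accessible_closed_set1/hausdorff_accessible/hausdorff_plane.
exists (closure (E false) `|` [set x]), (closure (E true) `|` [set x]).
split; [exact: clx|exact: clx| | |by split; exact: ex].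
  apply/seteqP; split => z.
    by move=> [[/clF|->]|[/clF|->]].
  move=> Fz; have [->|zx] := pselect (z = x); first by left; right.
  by have [Ez|Ez] := FEx _ Fz zx; [left|right]; left; exact: subset_closure.
apply/seteqP; split => z; last by move=> ->; split; right.
move=> [[z0|//] [z1|//]]; apply: contrapT => zx.
have [Ez|Ez] := FEx _ (clF _ _ z0) zx.
  by have : (E false `&` closure (E true)) z by []; rewrite sE2.
by have : (closure (E false) `&` E true) z by []; rewrite sE1.
Qed.

Lemma pair_cut_point x P Q : cut_pair x P Q -> cut_point F x.
Proof.
move=> [cP cQ PQ PQx [[p [Pp px]] [q [Qq qx]]]].
have [Px Qx] : (P `&` Q) x by rewrite PQx.
split; first by rewrite -PQ; left.
have disj A B : closed A -> A `&` B = [set x] ->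
    closure (A `\ x) `&` (B `\ x) = set0.
  move=> cA AB; apply/seteqP; split => z // [clz [Bz zx]]; apply: zx.
  suff : (A `&` B) z by rewrite AB.
  by split => //; rewrite (closure_id A).1 //; apply: closureS clz; exact: subDsetl.
apply/connectedPn; exists (fun b => if b then Q `\ x else P `\ x); split.
- by case; [exists q|exists p].
- by rewrite -PQ setDUl.
- by split; [exact: disj|rewrite setIC; apply: disj => //; rewrite setIC].
Qed.

Lemma cell_connected a : connected (phi a @` F).
Proof.
apply: connected_continuous_connected Fc _.
by apply: continuous_subspaceT; exact: phi_continuous.
Qed.

Lemma cell_closed a : closed (phi a @` F).
Proof.
apply: compact_closed (@hausdorff_plane R) _.
apply: continuous_compact (F_compact gsc).
by apply: continuous_subspaceT; exact: phi_continuous.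
Qed.

Lemma cells_closed (A : {set 'I_N * 'I_N}) : closed (cells A F).
Proof.
apply: closed_bigcup; first exact: finite_finset.
by move=> a _; exact: cell_closed.
Qed.

Lemma cut_pair_side x P Q K : cut_pair x P Q -> connected K -> K `<=` F ->
  ~ K x -> K `<=` P \/ K `<=` Q.
Proof.
move=> [cP cQ PQ PQx _] cK KF Kx.
apply: connected_closed_cover => //; first by rewrite PQ.
by rewrite -setIA PQx; apply/seteqP; split => z // [Kz zx]; apply: Kx; rewrite -zx.
Qed.

Definition pullback a P := F `&` phi a @^-1` P.

(** If every cell were inside P or inside Q, the cells in P and the remaining ones would share x
    alone, connectedness ensuring that they meet, and F would be fragile. A cell on neither side
    contains x and inherits a cut. *)
Lemma cut_pair_descend x P Q : ~ fragile D F -> cut_pair x P Q ->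
  exists a x', [/\ a \in D, x = phi a x' &
    cut_pair x' (pullback a P) (pullback a Q)].
Proof.
move=> nf xPQ; have [cP cQ PQ PQx [[p0 [Pp0 p0x]] [q0 [Qq0 q0x]]]] := xPQ.
have [Px Qx] : (P `&` Q) x by rewrite PQx.
have cellF a : a \in D -> phi a @` F `<=` F.
  by move=> aD _ [z Fz <-]; exact: (F_phi gsc).
have [[a [aD naP naQ]]|nex] := pselect (exists a,
    [/\ a \in D, ~ phi a @` F `<=` P & ~ phi a @` F `<=` Q]).
  have [x' Fx' xE] : (phi a @` F) x.
    apply: contrapT => nx.
    by have [] := cut_pair_side xPQ (cell_connected (a := a)) (cellF _ aD) nx.
  have cpre A : closed A -> closed (pullback a A).
    move=> cA; apply: closedI (F_closed gsc) _.
    by apply: closed_comp cA => z _; exact: phi_continuous.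
  have ex A B : A `|` B = F -> B x -> ~ phi a @` F `<=` B ->
      exists p, pullback a A p /\ p <> x'.
    move=> AB Bx nB; have [_ [[p Fp <-] nBp]] : exists p, (phi a @` F) p /\ ~ B p.
      by apply: contrapT => nn; apply: nB => p ap; apply: contrapT => nBp; apply: nn; exists p.
    exists p; split; last by move=> px; apply: nBp; rewrite px xE.
    split => //; have : F (phi a p) by exact: (F_phi gsc).
    by rewrite -AB => -[].
  exists a, x'; split => //; split; [exact: cpre|exact: cpre| | |split].
  - rewrite /pullback -setIUr -preimage_setU PQ.
    by apply/seteqP; split => [z []//|z Fz]; split => //; exact: (F_phi gsc).
  - apply/seteqP; split => z.
      move=> [[Fz Pz] [_ Qz]]; apply: (@phi_inj _ _ a); rewrite xE.
      by have : (P `&` Q) (phi a z) by []; rewrite PQx.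
    by move=> ->; split; split => //; rewrite /preimage /= xE.
  - exact: (ex P Q).
  - by apply: (ex Q P) => //; rewrite setUC.
exfalso; apply: nf.
pose D1 := [set a in D | `[< phi a @` F `<=` P >]]%SET.
have D1P : cells D1 F `<=` P.
  by move=> z [a]; rewrite /= inE => /andP[aD /asboolP aP] /aP.
have D2Q : cells (D :\: D1) F `<=` Q.
  move=> z [a]; rewrite /= !inE andbC => /andP[aD]; rewrite aD /= => /asboolPn aP az.
  by apply: contrapT => nQ; apply: nex; exists a; split => // aQ; apply: nQ; exact: aQ.
have DU : D = (D1 :|: D :\: D1)%SET.
  by apply/setP => a; rewrite !inE; case: (a \in D) => //=; case: asboolP.
exists D1, (D :\: D1)%SET; split => //.
  by apply/setP => a; rewrite !inE; case: (a \in D) => //=; case: asboolP.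
have FU : F `<=` cells D1 F `|` cells (D :\: D1)%SET F.
  move=> z /(F_cover gsc)[a [q [aD Fq ->]]].
  have := aD; rewrite {1}DU inE => /orP[aD1|aD2]; [left|right];
    by exists a => //; exists q.
exists x; apply/seteqP; split => z.
  by move=> [/D1P Pz /D2Q Qz]; rewrite -PQx.
move=> ->; apply: contrapT => nx.
have [FD1|FD2] : F `<=` cells D1 F \/ F `<=` cells (D :\: D1)%SET F.
  apply: connected_closed_cover => //; [exact: cells_closed|exact: cells_closed|].
  apply/seteqP; split => z0 // [[_ z1] z2]; apply: nx.
  have : (P `&` Q) z0 by split; [exact: D1P|exact: D2Q].
  by rewrite PQx => <-.
- apply: q0x; have : (P `&` Q) q0; last by rewrite PQx.
  by split => //; apply/D1P/FD1; rewrite -PQ; right.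
- apply: p0x; have : (P `&` Q) p0; last by rewrite PQx.
  by split => //; apply/D2Q/FD2; rewrite -PQ; left.
Qed.

End CutPairs.

(** * Chains of cut points *)

Lemma last_before_failure (A : nat -> Prop) n :
  A n -> ~ (forall k, n <= k -> A k) ->
  exists k, [/\ n <= k, forall i, n <= i <= k -> A i & ~ A k.+1].
Proof.
move=> An nA; apply: contrapT => nk; apply: nA.
suff H k : forall i, n <= i <= n + k -> A i.
  by move=> k nk'; apply: (H (k - n)%N); rewrite subnKC// nk' leqnn.
elim: k => [|k IH] i; first by rewrite addn0 -eqn_leq => /eqP <-.
rewrite addnS => /andP[ni]; rewrite leq_eqVlt => /orP[/eqP ->|ik]; last first.
  by apply: IH; rewrite ni -ltnS.
apply: contrapT => nAk; apply: nk; exists (n + k)%N; split => //.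
exact: leq_addr.
Qed.

Section Chains.
Local Open Scope classical_set_scope.
Local Open Scope ring_scope.
Variables (R : realType) (N : nat) (D : {set 'I_N * 'I_N}) (F : set (R * R)).
Hypotheses (N2 : (2 <= N)%N) (gsc : is_GSC D F) (Fc : connected F).
Hypotheses (nf : ~ fragile D F) (D2 : (1 < #|D|)%N).
Implicit Types (a b c j : 'I_N * 'I_N) (p q : R * R) (u v : int * int).
Implicit Types (x : nat -> R * R) (P Q : nat -> set (R * R)) (d : nat -> 'I_N * 'I_N).

Definition chain x P Q d := forall n,
  [/\ cut_pair F (x n) (P n) (Q n), d n \in D, x n = phi (d n) (x n.+1),
      P n.+1 = pullback F (d n) (P n) & Q n.+1 = pullback F (d n) (Q n)].

Lemma chainC x P Q d : chain x P Q d -> chain x Q P d.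
Proof. by move=> H n; have [? ? ? ? ?] := H n; split => //; exact: cut_pairC. Qed.

Lemma exists_chain (z : R * R) : cut_point F z -> exists x P Q d, chain x P Q d.
Proof.
move=> /cut_point_pair -/(_ _ _ gsc) [P0 [Q0 zPQ]].
pose X := {y : (R * R) * (set (R * R) * set (R * R)) | cut_pair F y.1 y.2.1 y.2.2}.
pose next (y y' : X) := exists a, [/\ a \in D, (sval y).1 = phi a (sval y').1,
  (sval y').2.1 = pullback F a (sval y).2.1 &
  (sval y').2.2 = pullback F a (sval y).2.2].
have nextP (y : X) : {y' | next y y'}.
  apply: cid; case: y => [[x [P Q]] /= xPQ].
  have [a [x' [aD xE xPQ']]] := cut_pair_descend gsc Fc nf xPQ.
  by exists (exist _ (x', (pullback F a P, pullback F a Q)) xPQ'), a.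
have [f [_ fS]] := dependent_choice nextP (exist _ (z, (P0, Q0)) zPQ).
have [d dE] := choice fS.
exists (fun n => (sval (f n)).1), (fun n => (sval (f n)).2.1),
  (fun n => (sval (f n)).2.2), d => n.
by have [? ? ? ?] := dE n; split => //; exact: (svalP (f n)).
Qed.

Definition pinned x d := forall n a q, a \in D -> F q -> x n = phi a q -> a = d n.

Lemma chain_in x P Q d n : chain x P Q d -> [/\ F (x n), P n (x n) & Q n (x n)].
Proof.
move=> /(_ n)[[_ _ PQ PQx _] _ _ _ _].
have [Px Qx] : (P n `&` Q n) (x n) by rewrite PQx.
by split => //; rewrite -PQ; left.
Qed.

(** A coordinate of [x n] that is 0 or 1 stays so, and [x n] lies in cells with
    different digits only when that coordinate becomes 0 or 1. *)
Lemma coord_eventually_pinned (f : R * R -> R) (e : 'I_N * 'I_N -> 'I_N) x P Q d :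
    chain x P Q d ->
    (forall p, F p -> 0 <= f p <= 1) ->
    (forall a p, f (phi a p) = N%:R^-1 * (f p + (e a : nat)%:R)) ->
  exists K, forall n a q, (K <= n)%N -> a \in D -> F q ->
    x n = phi a q -> e a = e (d n).
Proof.
move=> ch f01 fphi.
have N0 : (N%:R : R) != 0 := Nneq0 R N2.
have fE a p : N%:R * f (phi a p) = f p + (e a : nat)%:R by rewrite fphi mulVKf.
have eN a : (e a : nat)%:R + 1 <= (N%:R : R) by rewrite natr1 ler_nat.
have e0 a : 0 <= ((e a : nat)%:R : R) by rewrite ler0n.
pose ext n := f (x n) = 0 \/ f (x n) = 1.
have Fx n : F (x n) by have [] := chain_in n ch.
have xE n : N%:R * f (x n) = f (x n.+1) + (e (d n) : nat)%:R.
  by have [_ _ E _ _] := ch n; rewrite {1}E fE.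
have ext_S n : ext n -> ext n.+1.
  have := xE n; have := f01 _ (Fx n.+1); have := eN (d n); have := e0 (d n).
  move=> h1 h2 /andP[h3 h4] E [] xn; rewrite xn in E; [left|right]; lra.
have ext_branch n a q : a \in D -> F q -> x n = phi a q -> e a != e (d n) ->
    ext n.+1 /\ ~ ext n.
  move=> aD Fq xa ne; have E1 := xE n; have E2 := fE a q; rewrite -xa in E2; clear xa.
  have := f01 _ (Fx n.+1); have := f01 _ Fq => /andP[h1 h2] /andP[h3 h4].
  have {ne} : (e a < e (d n))%N \/ (e (d n) < e a)%N.
    by apply/orP; rewrite -neq_ltn.
  have n1 i k : (i < k)%N -> (i%:R + 1 <= k%:R :> R) by rewrite natr1 ler_nat.
  have := eN (d n); have := e0 (d n); have := eN a; have := e0 a.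
  move=> k1 k2 k3 k4 [] /n1 lt; split.
  - by left; lra. 
  - by move=> [] xn; rewrite xn in E1 E2; lra.
  - by right; lra.
  - by move=> [] xn; rewrite xn in E1 E2; lra.
have [[K extK]|noext] := pselect (exists n, ext n).
  exists K => n a q Kn aD Fq xa; apply/eqP/negPn/negP => ne.
  have [_] := ext_branch n a q aD Fq xa ne; apply.
  by rewrite -(subnK Kn); elim: (n - K)%N => // k IH; rewrite addSn; exact: ext_S.
exists 0%N => n a q _ aD Fq xa; apply/eqP/negPn/negP => ne.
by have [e1 _] := ext_branch n a q aD Fq xa ne; apply: noext; exists n.+1.
Qed.

Lemma exists_pinned_chain (z : R * R) : cut_point F z ->
  exists x P Q d, chain x P Q d /\ pinned x d.
Proof.
move=> /exists_chain[x [P [Q [d ch]]]].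
have bd p : F p -> 0 <= p.1 <= 1 /\ 0 <= p.2 <= 1.
  by move=> /(F_bounds N2 gsc)/andP.
have [K1 H1] := coord_eventually_pinned (f := fst) (e := fst) ch
  (fun p Fp => proj1 (bd p Fp)) (@phi1 R N).
have [K2 H2] := coord_eventually_pinned (f := snd) (e := snd) ch
  (fun p Fp => proj2 (bd p Fp)) (@phi2 R N).
pose K := maxn K1 K2.
exists (fun n => x (K + n)%N), (fun n => P (K + n)%N), (fun n => Q (K + n)%N),
  (fun n => d (K + n)%N); split => [n|n a q aD Fq xa].
  by rewrite addnS; exact: ch.
apply: pair_ext.
  by apply: H1 xa => //; rewrite (leq_trans _ (leq_addr _ _))// leq_maxl.
by apply: H2 xa => //; rewrite (leq_trans _ (leq_addr _ _))// leq_maxr.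
Qed.

(** The level n is monochromatic, the cell [d n] of the cut point being left out. *)
Definition mono P d n := forall a, a \in D -> a <> d n -> phi a @` F `<=` P n.

(** The cells other than [d n] lie in P and can meet Q only at the cut point, so any other point of
    Q shares its digit with [x n]. *)
Lemma chain_stay x P Q d n a q : chain x P Q d -> mono P d n ->
  Q n (phi a q) -> phi a q <> x n -> a \in D -> F q ->
  [/\ a = d n, Q n.+1 q & q <> x n.+1].
Proof.
move=> ch mP Qp px aD Fq; have [[_ _ _ PQx _] _ xE _ QE] := ch n.
have ad : a = d n.
  apply: contrapT => ad; apply: px.
  have : (P n `&` Q n) (phi a q) by split => //; apply: mP aD ad _ _; exists q.
  by rewrite PQx.
split => //; first by rewrite QE; split => //; rewrite -ad.
by move=> qx; apply: px; rewrite qx xE ad.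
Qed.

Definition digit_diff a b : int * int :=
  ((b.1 : nat)%:Z - (a.1 : nat)%:Z, (b.2 : nat)%:Z - (a.2 : nat)%:Z).

Lemma phi_unshift a b p : phi a p = phi b (unshift (digit_diff a b) p).
Proof.
apply: pair_ext; rewrite ?phi1 ?phi2 /unshift /digit_diff /= rmorphB /= -!pmulrn;
  congr (_ * _); ring.
Qed.

Lemma digit_diff_eq0 a b : digit_diff a b = 0 -> b = a.
Proof. by move=> [] /eqP + /eqP; rewrite !subr_eq0 => /eqP[?] /eqP[?]; apply: pair_ext; exact: val_inj. Qed.

(** The neighbours of the cell [d n] lie in Q, hence so do its contacts with them; lying in a second
    cell, these differ from the pinned point. *)
Lemma chain_enter x P Q d n b p : chain x P Q d -> pinned x d -> mono Q d n ->
  b \in D -> b <> d n -> contact F (digit_diff (d n) b) p ->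
  Q n.+1 p /\ p <> x n.+1.
Proof.
move=> ch pin mQ bD bd [Fp Fs]; have [_ _ xE _ QE] := ch n; split.
  rewrite QE; split => //; rewrite /preimage /= (phi_unshift _ b).
  by apply: mQ bD bd _ _; exists (unshift (digit_diff (d n) b) p).
move=> px; apply: bd; apply: (pin n _ _ bD Fs).
by rewrite -phi_unshift px.
Qed.

(** The effect of a colour change: the level n puts the contacts in Q, and at the level n + 1 only
    the cell [d n.+1] holds points of Q off the cut point. *)
Lemma chain_exclusive x P Q d n b : chain x P Q d -> pinned x d ->
  mono Q d n -> mono P d n.+1 -> b \in D -> b <> d n ->
  exclusive D F (digit_diff (d n) b) (d n.+1).
Proof.
move=> ch pin mQ mP bD bd a p aD Fp cp.
have [Qp px] := chain_enter ch pin mQ bD bd cp.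
by have [] := chain_stay ch mP Qp px aD Fp.
Qed.

(** Otherwise a point of Q off the cut point would share all its digits with the cut point, hence
    coincide with it. *)
Lemma not_eventually_mono x P Q d n : chain x P Q d ->
  ~ (forall k, (n <= k)%N -> mono P d k).
Proof.
move=> ch mP; have [[_ _ _ _ [_ [q [Qq qx]]]] _ _ _ _] := ch n.
have N0 : (N%:R : R) != 0 := Nneq0 R N2.
have H k : exists q', [/\ Q (n + k)%N q', q' <> x (n + k)%N,
    `|q.1 - (x n).1| * N%:R ^+ k = `|q'.1 - (x (n + k)%N).1| &
    `|q.2 - (x n).2| * N%:R ^+ k = `|q'.2 - (x (n + k)%N).2|].
  elim: k => [|k [q' [Qq' qx' E1 E2]]].
    by exists q; rewrite addn0 expr0 !mulr1.
  have Fq' : F q' by have [[_ _ <- _ _] _ _ _ _] := ch (n + k)%N; right.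
  have [a [r [aD Fr qE]]] := F_cover gsc Fq'.
  rewrite qE in Qq' qx'.
  have [ad Qr rx] := chain_stay ch (mP _ (leq_addr _ _)) Qq' qx' aD Fr.
  have [_ _ xE _ _] := ch (n + k)%N.
  exists r; rewrite addnS; split => //.
    rewrite exprSr mulrA E1 qE xE ad !phi1 -mulrBr normrM normfV (ger0_norm (ler0n _ _)).
    by rewrite mulrC mulVKf// opprD addrACA subrr addr0.
  rewrite exprSr mulrA E2 qE xE ad !phi2 -mulrBr normrM normfV (ger0_norm (ler0n _ _)).
  by rewrite mulrC mulVKf// opprD addrACA subrr addr0.
apply: qx; apply: pair_ext; apply/eqP; rewrite -subr_eq0; apply/eqP;
  apply: (geometric_eq0 N2) => k;
  have [q' [Qq' _ E1 E2]] := H k; rewrite ?E1 ?E2;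
  have Fq' : F q' by [have [[_ _ <- _ _] _ _ _ _] := ch (n + k)%N; right];
  have [Fx _ _] := chain_in (n + k)%N ch;
  have /andP[/andP[? ?] /andP[? ?]] := F_bounds N2 gsc Fq';
  have /andP[/andP[? ?] /andP[? ?]] := F_bounds N2 gsc Fx;
  by rewrite ler_norml; apply/andP; split; lra.
Qed.

(** Split off the digit a: its cell meets the union of the others by connectedness, and in more than
    one point by non-fragility. The neighbours b and c may coincide. *)
Lemma nonfragile_contacts a : a \in D -> exists b c p q,
  [/\ b \in D, c \in D, b <> a /\ c <> a,
      contact F (digit_diff a b) p /\ contact F (digit_diff a c) q & p <> q].
Proof.
move=> aD; apply: contrapT => nex; apply: nf.
exists [set a]%SET, (D :\ a)%SET; split.
- by rewrite finset.setD1K.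
- by apply/setP => b; rewrite !inE andbA andbN.
have [b0 b0D] : exists b, b \in (D :\ a)%SET.
  by apply/finset.set0Pn; rewrite -card_gt0; move: D2; rewrite (cardsD1 a D) aD.
have F0 : F !=set0 by case: gsc.
have [z [z1 z2]] : (cells [set a]%SET F `&` cells (D :\ a)%SET F) !=set0.
  apply: contrapT => nz; have [p Fp] := F0.
  have zz : F `&` cells [set a]%SET F `&` cells (D :\ a)%SET F = set0.
    by apply/seteqP; split => z // [[_ ?] ?]; apply: nz; exists z.
  have cov : F `<=` cells [set a]%SET F `|` cells (D :\ a)%SET F.
    move=> z /(F_cover gsc)[b [q [bD Fq ->]]].
    have [->|ba] := eqVneq b a; [left|right].
      by exists a; [rewrite /= inE|exists q].
    by exists b; [rewrite /= !inE ba|exists q].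
  have Fab b : b \in D -> F (phi b p) by move=> bD; exact: (F_phi gsc).
  have b0D' : b0 \in D by move: b0D; rewrite !inE => /andP[].
  have [H|H] := connected_closed_cover Fc (cells_closed gsc (A := _))
    (cells_closed gsc (A := _)) cov zz.
    have : set0 (phi b0 p) by rewrite -zz; split; [split => //; [exact: Fab|exact/H/Fab]|
      exists b0 => //; exists p].
    by [].
  have : set0 (phi a p) by rewrite -zz; split; [split => //; [exact: Fab|
     exists a; [rewrite /= inE|exists p]]|exact/H/Fab].
  by [].
exists z; apply/seteqP; split => [y [y1 y2]|_ ->]; last by split.
apply: contrapT => yz; apply: nex.
have get y0 : cells [set a]%SET F y0 -> cells (D :\ a)%SET F y0 ->
    exists b p, [/\ b \in D, b <> a, contact F (digit_diff a b) p & y0 = phi a p].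
  move=> [a' /= /[!inE] /eqP -> [p Fp <-]] [b /= /[!inE] /andP[/eqP ba bD] [q Fq qp]].
  exists b, p; split => //; split => //.
  by move: qp; rewrite (phi_unshift a b) => /phi_inj <-.
have [b [p [bD ba cp yE]]] := get _ y1 y2.
have [c [q [cD ca cq zE]]] := get _ z1 z2.
by exists b, c, p, q; split => // pq; apply: yz; rewrite yE zE pq.
Qed.

(** If every contact of the cell [d n] were a single point, [exclusive_two] would identify all of
    them, against [nonfragile_contacts]. A contact with two points is not diagonal. *)
Lemma big_contact x P Q d n : chain x P Q d -> pinned x d ->
  mono Q d n -> mono P d n.+1 ->
  exists b p q, let u := digit_diff (d n) b in
   [/\ b \in D, edge u, exclusive D F u (d n.+1), contact F u p /\ contact F u q & p <> q].
Proof.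
move=> ch pin mQ mP; have [_ dD _ _ _] := ch n.
have [b [c [p [q [bD cD [bd cd] [cp cq] pq]]]]] := nonfragile_contacts dD.
have exb := chain_exclusive ch pin mQ mP bD bd.
have exc := chain_exclusive ch pin mQ mP cD cd.
have ub : digit_diff (d n) b != 0 by apply/eqP => /digit_diff_eq0.
have uc : digit_diff (d n) c != 0 by apply/eqP => /digit_diff_eq0.
have big e r r' : e \in D -> exclusive D F (digit_diff (d n) e) (d n.+1) ->
    digit_diff (d n) e != 0 -> contact F (digit_diff (d n) e) r ->
    contact F (digit_diff (d n) e) r' -> r <> r' ->
  exists b p q, let u := digit_diff (d n) b in
   [/\ b \in D, edge u, exclusive D F u (d n.+1), contact F u p /\ contact F u q & p <> q].
  move=> eD exe ue cr cr' rr'; exists e, r, r'; split => //.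
  have [//|[u1 u2]] := edge_or_diag N2 gsc cr ue.
  by exfalso; apply: rr'; exact: (contact_diag N2 gsc u1 u2 cr cr').
have [H|/existsNP[r /existsNP[r' /not_implyP[cr /not_implyP[cr' rr']]]]] := pselect
  (forall p p', contact F (digit_diff (d n) b) p ->
     contact F (digit_diff (d n) b) p' -> p = p'); last exact: (big b r r').
have [H'|/existsNP[r /existsNP[r' /not_implyP[cr /not_implyP[cr' rr']]]]] := pselect
  (forall p p', contact F (digit_diff (d n) c) p ->
     contact F (digit_diff (d n) c) p' -> p = p'); last exact: (big c r r').
exfalso; apply: pq.
have [E|E] := eqVneq (digit_diff (d n) b) (digit_diff (d n) c).
  by apply: H cp _; rewrite E.
exact: (exclusive_two N2 gsc exb exc ub uc E H H' cp cq).
Qed.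

(** As [phi j] maps [contact u] into itself, by induction all of [contact u] lies in Q, off the cut
    point, at every level of the run; this forces the digit j. *)
Lemma chain_run x P Q d n m j b c p : chain x P Q d -> pinned x d ->
  mono Q d n -> (forall k, (n < k <= m)%N -> mono P d k) ->
  b \in D -> b <> d n -> let u := digit_diff (d n) b in
  exclusive D F u j -> j \in D -> c \in D -> subpos u j c = u -> contact F u p ->
  forall k, (n < k <= m)%N -> d k = j.
Proof.
move=> ch pin mQ mP bD bd u exj jD cD cE cp.
pose stays k := forall q, contact F u q -> Q k q /\ q <> x k.
have dj k : (n < k <= m)%N -> stays k -> d k = j.
  move=> km /(_ p cp)[Qp px]; have [e [q [_ pE [Fq _]]]] := exclusive_unfold N2 gsc exj cp.
  rewrite pE in Qp px.
  by have [] := chain_stay ch (mP k km) Qp px jD Fq.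
suff H i : (n.+1 + i <= m)%N -> stays (n.+1 + i)%N.
  move=> k km; apply: dj => //; move: km => /andP[nk km].
  by rewrite -(subnKC nk); apply: H; rewrite subnKC.
elim: i => [|i IH] im q cq; first by rewrite addn0; exact: chain_enter cq.
rewrite addnS in im *.
have km : (n < n.+1 + i <= m)%N by rewrite leq_addr ltnW.
have [|Qq qx] := IH (ltnW im) (phi j q).
  by apply: (contact_phi N2 gsc jD cD); rewrite cE.
by have [] := chain_stay ch (mP _ km) Qq qx jD (proj1 cq).
Qed.

(** Otherwise the levels are monochromatic and change colour infinitely often:
    the two contacts given by [big_contact] at successive changes [n] and [m]
    are incompatible, because [d] is constant from [n.+1] to [m]. *)
Lemma exists_mixed_level x P Q d : chain x P Q d -> pinned x d ->
  exists n, ~ mono P d n /\ ~ mono Q d n.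
Proof.
move=> ch pin; apply: contrapT => nmix.
have PorQ n : mono P d n \/ mono Q d n.
  by apply: contrapT => /not_orP H; apply: nmix; exists n.
have nP n := not_eventually_mono (n := n) ch.
have nQ n := not_eventually_mono (n := n) (chainC ch).
have /existsNP[l /not_implyP[_ nPl]] := nP 0%N.
have Ql : mono Q d l by have [/nPl|] := PorQ l.
(* A run of colour Q ends at n, and the run of colour P starting at n + 1 ends at m. *)
have [n [ln Qln nQn]] := last_before_failure Ql (nQ l).
have PSn : mono P d n.+1 by have [|/nQn] := PorQ n.+1.
have [m [nm Pnm nPm]] := last_before_failure PSn (nP n.+1).
have Qn : mono Q d n by apply: Qln; rewrite ln leqnn.
have Pm : mono P d m by apply: Pnm; rewrite nm leqnn.
have QSm : mono Q d m.+1 by have [|//] := PorQ m.+1.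
have [b [p [q [bD eu exu [cp cq] pq]]]] := big_contact ch pin Qn PSn.
set u := digit_diff (d n) b in eu exu cp cq.
have [c cD cE] := exclusive_self_contact N2 gsc eu exu cp cq pq.
have jD : d n.+1 \in D by have [] := ch n.+1.
have bd : b <> d n by move=> bd; move: eu; rewrite /u bd /edge /digit_diff /= !subrr.
have dm : d m = d n.+1.
  by apply: (chain_run ch pin Qn _ bD bd exu jD cD cE cp (m := m)) => //; rewrite nm leqnn.
have [b' [p' [q' [b'D ev exv [cp' cq'] pq']]]] := big_contact (chainC ch) pin Pm QSm.
set v := digit_diff (d m) b' in ev exv cp' cq'.
(* If v = -u, the contact is exclusive from both sides and reduces to a point. *)
have [vu|vu] := eqVneq v (- u).
  by apply: pq; apply: (exclusive_opp N2 gsc eu exu (k := d m.+1) _ cp cq); rewrite -vu.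
have {}vu : v.1 <> - u.1 \/ v.2 <> - u.2.
  apply: contrapT => /not_orP[/contrapT ? /contrapT ?].
  by case/eqP: vu; exact: pair_ext.
have [C1 C2] := pair_inj2 cE; have [h1 h2] := ord_pair_lt c.
have [h3 h4] := ord_pair_lt b'.
have V1 : v.1 = (b'.1 : nat)%:Z - ((d n.+1).1 : nat)%:Z by rewrite /v dm.
have V2 : v.2 = (b'.2 : nat)%:Z - ((d n.+1).2 : nat)%:Z by rewrite /v dm.
(* Nor is v equal to u: by [cE] the digit [d n.+1] is on the side of the square facing u, with no
   digit beyond it. So v is transverse to u. *)
have par : v.1 * u.1 + v.2 * u.2 = 0.
  clear - N2 eu ev vu C1 C2 h1 h2 h3 h4 V1 V2; clearbody u v.
  case/edgeP: eu => uE; rewrite uE in C1 C2 vu *; case/edgeP: ev => vE;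
    rewrite vE in V1 V2 vu *; simpl in *; lia.
apply: pq; apply: (exclusive_side N2 gsc eu exu cD cE b'D _ _ cp cq).
  by rewrite -V1 -V2; exact/eqP.
by rewrite -V1 -V2.
Qed.
End Chains.

(** * Words and Hata graphs *)

(** Since K is positive, the default value 0 of [nth] does not count as an entry. *)
Lemma second_largest_ge (s : seq nat) K : 0 < K ->
  (K <= nth 0 (sort geq s) 1) = (1 < count (leq K) s).
Proof.
move=> K0; have total_geq : total geq by move=> m n; exact: leq_total.
have st := sort_sorted total_geq s.
rewrite -[in RHS](count_sort geq).
case: (sort geq s) st => [|m [|n t]] /=; [by rewrite leqNgt K0|
  by rewrite leqNgt K0 addn0; case: (K <= m)|].
have geq_tr : transitive geq by move=> a b c ba cb; exact: leq_trans cb ba.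
move=> /andP[nm]; rewrite path_sortedE// => /andP[/allP nt _].
have [Kn|nK] := leqP K n; first by rewrite (leq_trans Kn nm).
have -> : count (leq K) t = 0.
  apply/eqP; rewrite -leqn0 leqNgt -has_count; apply/hasPn => k /nt /= kn.
  by rewrite -ltnNge (leq_ltn_trans kn nK).
by case: (K <= m).
Qed.

Lemma component_sizes_ge (V : finType) (e : rel V) (v : V) K : 0 < K ->
  K <= nth 0 (component_sizes e v) 1 <-> exists A B : {set V},
    [/\ A \in del_components e v, B \in del_components e v, A != B,
        K <= #|A| & K <= #|B|].
Proof.
move=> K0; rewrite /component_sizes second_largest_ge// count_map -size_filter.
set X := del_components e v; set s := seq.filter _ _.
have su : uniq s by rewrite filter_uniq// enum_uniq.
have sE A : (A \in s) = (A \in X) && (K <= #|A|) by rewrite mem_filter mem_enum andbC.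
split=> [|[A [B [AX BX AB KA KB]]]]; last first.
  have : {subset [:: A; B] <= s}.
    by move=> C; rewrite !inE sE => /orP[] /eqP ->; apply/andP.
  by move/(uniq_leq_size _); rewrite /= !inE andbT; apply.
case: s su sE => [//|A [//|B s]] su sE _; exists A, B.
have := sE A; have := sE B; rewrite !inE !eqxx orbT /=.
move=> /esym/andP[BX KB] /esym/andP[AX KA]; split => //.
by move: su; rewrite /= inE negb_or => /andP[/andP[]].
Qed.

Section Words.
Local Open Scope classical_set_scope.
Local Open Scope ring_scope.
Variables (R : realType) (N : nat) (D : {set 'I_N * 'I_N}) (F : set (R * R)).
Hypotheses (N2 : (2 <= N)%N) (gsc : is_GSC D F) (Fc : connected F).
Implicit Types (p q : R * R).
Notation letter := {i : 'I_N * 'I_N | i \in D}.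

Lemma phi_word_cons n (a : letter) (s : word D n) :
  phi_word (R := R) (cons_tuple a s : word D n.+1) = phi (val a) \o phi_word s.
Proof. by []. Qed.

Lemma word_consP n (w : word D n.+1) : exists (a : letter) (s : word D n),
  w = cons_tuple a s.
Proof. by case/tupleP: w => a s; exists a, s. Qed.

Lemma word0 (w w' : word D 0) : w = w'.
Proof. by rewrite (tuple0 w) (tuple0 w'). Qed.

Lemma F_phi_word n (w : word D n) q : F q -> F (phi_word w q).
Proof.
elim: n w q => [|n IH] w q Fq; first by rewrite (tuple0 w).
have [a [s ->]] := word_consP w; rewrite phi_word_cons.
by apply: (F_phi gsc); [exact: valP|exact: IH].
Qed.

Lemma phi_word_inj n (w : word D n) : injective (phi_word w : R * R -> R * R).
Proof.
elim: n w => [|n IH] w; first by rewrite (tuple0 w).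
have [a [s ->]] := word_consP w; rewrite phi_word_cons.
exact: inj_comp (@phi_inj _ _ _) (IH s).
Qed.

Lemma phi_word_continuous n (w : word D n) : continuous (phi_word w : R * R -> R * R).
Proof.
elim: n w => [|n IH] w; first by rewrite (tuple0 w) => p; exact: cvg_id.
have [a [s ->]] := word_consP w; rewrite phi_word_cons => p.
by apply: continuous_comp; [exact: IH|exact: phi_continuous].
Qed.

Lemma F_cover_word n p : F p -> exists (w : word D n) q, F q /\ p = phi_word w q.
Proof.
elim: n p => [|n IH] p Fp; first by exists [tuple], p.
have [a [q [aD /IH[s [r [Fr ->]]] ->]]] := F_cover gsc Fp.
by exists (cons_tuple (exist _ a aD) s), r.
Qed.

Lemma word_cell_connected n (w : word D n) : connected (phi_word w @` F).
Proof.
apply: connected_continuous_connected Fc _.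
by apply: continuous_subspaceT; exact: phi_word_continuous.
Qed.

Lemma word_cell_closed n (w : word D n) : closed (phi_word w @` F).
Proof.
apply: compact_closed (@hausdorff_plane R) _.
apply: continuous_compact (F_compact gsc).
by apply: continuous_subspaceT; exact: phi_word_continuous.
Qed.

Lemma word_cells_closed n (A : {set word D n}) :
  closed (\bigcup_(w in [set` A]) (phi_word w @` F)).
Proof.
apply: closed_bigcup; first exact: finite_finset.
by move=> w _; exact: word_cell_closed.
Qed.

Lemma hata_sym n : symmetric (hata_graph D F n).
Proof. by move=> w w'; rewrite /hata_graph /= eq_sym setIC. Qed.

(** The cells reachable from w and the other ones would split F into two disjoint closed sets. *)
Lemma hata_connected n (w w' : word D n) : connect (hata_graph D F n) w w'.
Proof.
have [q0 Fq0] : F !=set0 by case: gsc.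
pose C := [set w' | connect (hata_graph D F n) w w']%SET.
pose U A := \bigcup_(w in [set` (A : {set word D n})]) (phi_word w @` F).
have cov : F `<=` U C `|` U (~: C)%SET.
  move=> p /(F_cover_word n)[s [q [Fq ->]]].
  have [sC|sC] := boolP (s \in C); [left|right].
    by exists s => //; exists q.
  by exists s; [rewrite /= finset.in_setC|exists q].
have dis z : U C z -> U (~: C)%SET z -> False.
  case=> s1 /= sC zs; case=> t1 /= tC zt; move: sC tC; rewrite !inE => sC /negP; apply.
  have [<-//|st] := eqVneq s1 t1; apply: connect_trans sC (connect1 _).
  by rewrite /hata_graph /= st; apply/asboolP; exists z.
have U0 s (A : {set word D n}) : s \in A -> U A (phi_word s q0) by move=> sA; exists s => //; exists q0.
apply: contrapT => ww'.
have [H|H] : F `<=` U C \/ F `<=` U (~: C)%SET.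
  apply: connected_closed_cover => //; try exact: word_cells_closed.
  by apply/seteqP; split => z // [[_ ?] ?]; exact: (dis z).
- apply: (dis (phi_word w' q0)); first exact/H/F_phi_word.
  by apply: U0; rewrite !inE; exact/negP.
- apply: (dis (phi_word w q0)); last exact/H/F_phi_word.
  by apply: U0; rewrite inE.
Qed.

Lemma hata_cons n (a : letter) (s t : word D n) :
  hata_graph D F n s t -> hata_graph D F n.+1 (cons_tuple a s) (cons_tuple a t).
Proof.
move=> /andP[st /asboolP[z [[p Fp pz] [q Fq qz]]]]; apply/andP; split.
  by apply: contra_neq st => /(congr1 val)[/val_inj].
apply/asboolP; exists (phi (val a) z); split.
  by exists p => //; rewrite -pz.
by exists q => //; rewrite -qz.
Qed.

Lemma card_word n : #|{: word D n}| = (#|D| ^ n)%N.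
Proof. by rewrite card_tuple card_sig; congr (_ ^ _)%N; apply: eq_card => i; rewrite inE. Qed.

End Words.

(** * Components of a graph with one vertex deleted *)

Lemma del_vertex_connectP (V : finType) (e : rel V) (v : V) : symmetric e ->
  {in (~: [set v])%SET & &, equivalence_rel (connect (del_vertex e v))}.
Proof.
move=> e_sym; have ds : symmetric (del_vertex e v).
  by move=> x y; rewrite /del_vertex /= e_sym andbCA.
move=> x y z _ _ _; split; first exact: connect0.
move=> xy; apply/idP/idP; last exact: connect_trans.
by apply: connect_trans; rewrite (sym_connect_sym ds).
Qed.

Lemma mem_del_component (V : finType) (e : rel V) (v x y : V) : symmetric e ->
  x != v -> y != v ->
  (y \in finset.pblock (del_components e v) x) = connect (del_vertex e v) x y.
Proof.
move=> e_sym xv yv.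
by rewrite (finset.pblock_equivalence_partition (del_vertex_connectP e_sym)) ?inE.
Qed.

Lemma del_component_mem (V : finType) (e : rel V) (v x : V) : symmetric e ->
  x != v -> finset.pblock (del_components e v) x \in del_components e v.
Proof.
move=> e_sym xv; have := finset.equivalence_partitionP (del_vertex_connectP (v := v) e_sym).
by move=> /finset.cover_partition cov; apply: finset.pblock_mem; rewrite cov !inE.
Qed.

(** * From cut points to cut vertices *)

Section Colouring.
Local Open Scope classical_set_scope.
Local Open Scope ring_scope.
Variables (R : realType) (N : nat) (D : {set 'I_N * 'I_N}) (F : set (R * R)).
Hypotheses (N2 : (2 <= N)%N) (gsc : is_GSC D F) (Fc : connected F).
Hypothesis (D2 : (1 < #|D|)%N).
Implicit Types (p q : R * R).
Notation letter := {i : 'I_N * 'I_N | i \in D}.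

Lemma cons_word_neq n (a c : letter) (s t : word D n) : a != c ->
  cons_tuple a s != cons_tuple c t.
Proof. by apply: contra_neq => /(congr1 val)[]. Qed.

(** The words with first letter a carry a copy of the connected Hata graph of level n avoiding the
    deleted vertex, hence lie in one component; likewise for b, and the colouring separates the two
    components. *)
Lemma colouring_chi n (c : letter) (t : word D n) (col : pred (word D n.+1))
    (a b : letter) :
    (forall w w', w != cons_tuple c t -> w' != cons_tuple c t ->
      hata_graph D F n.+1 w w' -> col w = col w') ->
    a != c -> b != c ->
    (forall s, col (cons_tuple a s)) -> (forall s, ~~ col (cons_tuple b s)) ->
  (#|D| ^ n <= chi (hata_graph D F n.+1))%N.
Proof.
set v := cons_tuple c t => colE ac bc cola colb.
set e := hata_graph D F n.+1; have e_sym : symmetric e := @hata_sym _ _ _ _ _.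
have av s : cons_tuple a s != v by exact: cons_word_neq.
have bv s : cons_tuple b s != v by exact: cons_word_neq.
have col_connect w w' : connect (del_vertex e v) w w' -> col w = col w'.
  move=> /connectP[l + ->]; elim: l w => //= w1 l IH w /andP[/and3P[wv w1v ww1]].
  by move=> /IH <-; exact: colE.
have same d (dv : forall s, cons_tuple d s != v) s s' :
    connect (del_vertex e v) (cons_tuple d s) (cons_tuple d s').
  have /connectP[l] := hata_connected gsc Fc s s'.
  elim: l s => [|s1 l IH] s /=; first by move=> _ ->; exact: connect0.
  move=> /andP[ss1 pl] ls; apply: connect_trans (IH _ pl ls); apply: connect1.
  by apply/and3P; split; [exact: dv|exact: dv|exact: hata_cons].
have K0 : (0 < #|D| ^ n)%N by rewrite expn_gt0 (ltnW D2).
have sizeb d (dv : forall s, cons_tuple d s != v) :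
    (#|D| ^ n <= #|finset.pblock (del_components e v) (cons_tuple d t)|)%N.
  rewrite -card_word; have cinj : injective (fun s : word D n => cons_tuple d s).
    by move=> s s' /(congr1 val)[/val_inj].
  rewrite -(card_imset _ cinj); apply: subset_leq_card; apply/fintype.subsetP => w.
  by move=> /imsetP[s _ ->]; rewrite mem_del_component//; exact: same.
have ncon : ~~ connect (del_vertex e v) (cons_tuple a t) (cons_tuple b t).
  by apply/negP => /col_connect E; have := colb t; rewrite -E cola.
apply: leq_trans (leq_bigmax_cond _ (_ : cut_vertex e v)); last first.
  by apply/existsP; exists (cons_tuple a t); apply/existsP; exists (cons_tuple b t); rewrite av bv.
apply/component_sizes_ge => //.
exists (finset.pblock (del_components e v) (cons_tuple a t)),
  (finset.pblock (del_components e v) (cons_tuple b t)); split.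
- exact: (del_component_mem e_sym (av t)).
- exact: (del_component_mem e_sym (bv t)).
- apply: contraNneq ncon => E; rewrite -(mem_del_component e_sym (av t) (bv t)) E.
  by rewrite (mem_del_component e_sym (bv t) (bv t)) connect0.
- exact: sizeb.
- exact: sizeb.
Qed.

Section FromChain.
Variables (x : nat -> R * R) (P Q : nat -> set (R * R)) (d : nat -> 'I_N * 'I_N).
Hypotheses (ch : chain D F x P Q d) (pin : pinned D F x d).

Definition chain_letter k : letter :=
  exist _ (d k) (let: And5 _ dD _ _ _ := ch k in dD).

Fixpoint chain_word k n : word D n :=
  if n is n'.+1 then cons_tuple (chain_letter k) (chain_word k.+1 n') else [tuple].

Lemma pinned_word k n (w : word D n) q : F q -> x k = phi_word w q ->
  w = chain_word k n.
Proof.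
elim: n k w q => [|n IH] k w q Fq; first by move=> _; exact: word0.
have [a [s ->]] := word_consP w; rewrite phi_word_cons /= => xE.
have ad : val a = d k by apply: pin xE; [exact: valP|exact: F_phi_word].
have -> : a = chain_letter k by exact: val_inj.
congr cons_tuple; apply: IH (Fq) _; have [_ _ xS _ _] := ch k.
by apply: (@phi_inj _ _ (d k)); rewrite -xS xE ad.
Qed.

(** Colour a word by whether its cell lies in P. Only the cell of [chain_word] contains [x k], so
    any other cell lies on one side, and two of these that meet have the same colour. *)
Lemma mixed_chi k n : ~ mono D F P d k -> ~ mono D F Q d k ->
  (#|D| ^ n <= chi (hata_graph D F n.+1))%N.
Proof.
move=> /existsNP[a /not_implyP[aD /not_implyP[ad aP]]].
move=> /existsNP[b /not_implyP[bD /not_implyP[bd bQ]]].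
have [xPQ _ _ _ _] := ch k; have [cP cQ PQ PQx _] := xPQ.
have cellF (w : word D n.+1) : phi_word w @` F `<=` F.
  by move=> _ [p Fp <-]; exact: (F_phi_word gsc).
have side (w : word D n.+1) : w != chain_word k n.+1 ->
    phi_word w @` F `<=` P k \/ phi_word w @` F `<=` Q k.
  move=> wv; apply: (cut_pair_side xPQ) => //; first exact: word_cell_connected.
  by move=> [q Fq qx]; case/eqP: wv; exact: (pinned_word (q := q)).
have side1 e : e \in D -> e <> d k -> phi e @` F `<=` P k \/ phi e @` F `<=` Q k.
  move=> eD ed; apply: (cut_pair_side xPQ); first exact: cell_connected.
    by move=> _ [p Fp <-]; exact: (F_phi gsc).
  by move=> [q Fq qx]; apply: ed; exact: (pin eD Fq).
have aQ : phi a @` F `<=` Q k by have [/aP|] := side1 _ aD ad.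
have bP : phi b @` F `<=` P k by have [|/bQ] := side1 _ bD bd.
have [q0 Fq0] : F !=set0 by case: gsc.
have nboth (w : word D n.+1) z : w != chain_word k n.+1 -> (phi_word w @` F) z ->
    P k z -> Q k z -> False.
  move=> wv [q Fq <-] Pz Qz; case/eqP: wv; apply: (pinned_word (q := q)) => //.
  by have : (P k `&` Q k) (phi_word w q) by []; rewrite PQx.
pose col : pred (word D n.+1) := fun w => `[< phi_word w @` F `<=` P k >].
have sub e (eD : e \in D) (s : word D n) :
    phi_word (cons_tuple (exist _ e eD : letter) s : word D n.+1) @` F `<=` phi e @` F.
  by move=> _ [q Fq <-]; exists (phi_word s q) => //; exact: (F_phi_word gsc).
apply: (@colouring_chi n (chain_letter k) (chain_word k.+1 n) col (exist _ b bD)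
  (exist _ a aD)) => [w w' wv w'v /andP[_ /asboolP[z [wz w'z]]]||||].
- apply/asboolP/asboolP => H.
    have [//|H'] := side _ w'v; exfalso.
    by apply: (nboth w z) => //; [exact: H|exact: H'].
  have [//|H'] := side _ wv; exfalso.
  by apply: (nboth w z) => //; [exact: H|exact: H'].
- by apply/eqP => /(congr1 val).
- by apply/eqP => /(congr1 val).
- by move=> s; apply/asboolP; exact: subset_trans (sub _ _ _) bP.
- move=> s; apply/asboolPn => H.
  have wz : (phi_word (cons_tuple (exist _ a aD : letter) s : word D n.+1) @` F)
     (phi_word (cons_tuple (exist _ a aD : letter) s : word D n.+1) q0) by exists q0.
  apply: (nboth _ _ _ wz (H _ wz) (aQ _ (sub _ _ _ _ wz))).
  by apply: cons_word_neq; apply/eqP => /(congr1 val).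
Qed.

End FromChain.

Lemma cut_point_chi n z : ~ fragile D F -> cut_point F z ->
  (#|D| ^ n <= chi (hata_graph D F n.+1))%N.
Proof.
move=> nf /(exists_pinned_chain N2 gsc Fc nf)[x [P [Q [d [ch pin]]]]].
have [k [nP nQ]] := exists_mixed_level N2 gsc Fc nf D2 ch pin.
exact: (mixed_chi ch pin n nP nQ).
Qed.

End Colouring.

(** * From cut vertices to cut points *)

Section Sequences.
Local Open Scope classical_set_scope.
Local Open Scope ring_scope.
Variables (R : realType) (N : nat) (D : {set 'I_N * 'I_N}) (F : set (R * R)).
Hypotheses (N2 : (2 <= N)%N) (gsc : is_GSC D F) (Fc : connected F).
Hypothesis (D2 : (1 < #|D|)%N).
Implicit Types (p q : R * R).
Notation letter := {i : 'I_N * 'I_N | i \in D}.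
Implicit Types (s t : seq letter).

(** [phi_word] on plain sequences, where prefixes and concatenations keep the same type. *)
Definition phis s : R * R -> R * R := foldr (fun i f => phi (val i) \o f) id s.


Lemma phis_tuple s : phis s = phi_word (in_tuple s : word D (size s)).
Proof. by []. Qed.

Lemma phis_cat s t p : phis (s ++ t) p = phis s (phis t p).
Proof. by elim: s => //= a s ->. Qed.

Lemma F_phis s q : F q -> F (phis s q).
Proof. by rewrite phis_tuple; exact: (F_phi_word gsc). Qed.

Lemma phis_inj s : injective (phis s).
Proof. by rewrite phis_tuple; exact: phi_word_inj. Qed.

Lemma phis_continuous s : continuous (phis s).
Proof. by rewrite phis_tuple; exact: phi_word_continuous. Qed.

Lemma cell_phis_connected s : connected (phis s @` F).
Proof. by rewrite phis_tuple; exact: word_cell_connected. Qed.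

Lemma F_cover_phis n p : F p -> exists t q, [/\ size t = n, F q & p = phis t q].
Proof.
by move=> /(F_cover_word gsc n)[w [q [Fq ->]]]; exists w, q; rewrite size_tuple.
Qed.

Lemma phis_closed_image s (A : set (R * R)) : closed A -> closed (phis s @` (F `&` A)).
Proof.
move=> cA; apply: compact_closed (@hausdorff_plane R) _; apply: continuous_compact.
  by apply: continuous_subspaceT; exact: phis_continuous.
exact: compact_closedI (F_compact gsc) cA.
Qed.

(** The lower left corner of the square of s, in units of its side. *)
Fixpoint pos s : int * int :=
  if s is a :: s' then ((((val a).1 : nat) * N ^ size s')%:Z + (pos s').1,
    (((val a).2 : nat) * N ^ size s')%:Z + (pos s').2) else 0.

Lemma phisE s p : phis s p = (N%:R ^- size s * (p.1 + (pos s).1%:~R),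
                              N%:R ^- size s * (p.2 + (pos s).2%:~R)).
Proof.
have N0 := Nneq0 R N2.
elim: s => [|a s IH] /=.
  by apply: pair_ext; rewrite /= expr0 invr1 mul1r addr0.
rewrite IH; apply: pair_ext; rewrite ?phi1 ?phi2 /= exprS invfM rmorphD /=
  -pmulrn natrM natrX -mulrA; congr (_ * _); rewrite addrA mulrDr mulrDr mulrDr;
  rewrite [_^-1 * (_ * _ ^+ _)]mulrC mulfK ?expf_neq0//; ring.
Qed.

Lemma phis_dist s p q : phis s p - phis s q = N%:R ^- size s *: (p - q).
Proof.
rewrite !phisE; apply: pair_ext; rewrite /= -mulrBr; congr (_ * _); ring.
Qed.

Lemma expN_gt1 n : (0 < n)%N -> 1 < N%:R ^+ n :> R.
Proof. by move=> n0; rewrite exprn_egt1 ?Ngt1// -lt0n. Qed.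

(** Minimise over F the distance of a point to its image; a nonzero minimum would be improved by
    passing to the image. *)
Lemma phis_fixpoint s : (0 < size s)%N -> exists2 y, F y & phis s y = y.
Proof.
move=> s0; have F0 : F !=set0 by case: gsc.
pose h p := `|phis s p - p|.
have ch : {within F, continuous h}.
  apply: continuous_subspaceT => p; apply: (@cvg_norm _ _ _ _ _ (fun p => phis s p - p)).
  by apply: cvgB; [exact: phis_continuous|exact: cvg_id].
have [c /[!inE] Fcc cmin] := compact_EVT_min F0 (F_compact gsc) ch.
exists c => //; have := cmin (phis s c) (mem_set (F_phis s Fcc)).
rewrite /h phis_dist normrZ normfV normrX normr_nat.
have N1 := expN_gt1 s0; rewrite ler_pdivlMl ?(lt_trans ltr01)// => H.
apply/eqP; rewrite -subr_eq0 -normr_le0.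
have := normr_ge0 (phis s c - c); move: H N1.
move: `|phis s c - c| (N%:R ^+ size s) => a b H N1 a0.
by nra.
Qed.

Lemma F_two_points : exists p q, [/\ F p, F q & p <> q].
Proof.
have [q0 Fq0] : F !=set0 by case: gsc.
have /card_gt1P[a [b [aD bD ab]]] := D2.
exists (phi a q0), (phi b q0); split; [exact: (F_phi gsc)|exact: (F_phi gsc)|].
move=> E; case/eqP: ab; have N0 := invr_neq0 (Nneq0 R N2).
apply: pair_ext; apply: val_inj; apply/eqP; rewrite -(eqr_nat R); apply/eqP.
  by move/(congr1 fst): E; rewrite !phi1 => /(mulfI N0)/addrI.
by move/(congr1 snd): E; rewrite !phi2 => /(mulfI N0)/addrI.
Qed.

End Sequences.

(** * The cut point of an eventually periodic word *)

Section Loop.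
Local Open Scope classical_set_scope.
Local Open Scope ring_scope.
Variables (R : realType) (N : nat) (D : {set 'I_N * 'I_N}) (F : set (R * R)).
Hypotheses (N2 : (2 <= N)%N) (gsc : is_GSC D F) (D2 : (1 < #|D|)%N).
Implicit Types (p q : R * R).
Notation letter := {i : 'I_N * 'I_N | i \in D}.
Implicit Types (s t : seq letter) (c : bool).

Variables (K : bool -> set (R * R)) (u r : seq letter).
Hypothesis K_disjoint : forall p, K true p -> K false p -> False.
Let ur := u ++ r.
Definition cell_in c s := phis s @` F `<=` K c.
Hypothesis cell_colour : forall s, size s = size ur -> s <> ur ->
  exists c, cell_in c s.
(** A coloured cell meeting the cell [ur] has a counterpart of the same colour, at the same relative
    position, around the cell u. *)
Hypothesis transfer : forall c s p q, size s = size ur -> s <> ur -> cell_in c s ->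
  F p -> F q -> phis s p = phis ur q ->
  exists s', [/\ size s' = size u, s' <> u, cell_in c s' & phis u q = phis s' p].
Hypothesis side_cell : forall c, exists a : letter, forall t,
  size t = (size ur).-1 -> a :: t <> ur /\ cell_in c (a :: t).
Hypothesis r_nonempty : (0 < size r)%N.

Let start c : set (R * R) := \bigcup_(s in
  [set` [set w : word D (size ur) | (tval w != ur) && `[< cell_in c w >]]%SET])
  (phi_word s @` F).

Lemma startP c p : start c p <-> exists s q,
  [/\ size s = size ur, s <> ur, cell_in c s, F q & p = phis s q].
Proof.
split=> [[w /=]|[s [q [ss su sc Fq ->]]]].
  rewrite inE => /andP[/eqP wu /asboolP wc] [q Fq <-].
  by exists w, q; rewrite size_tuple.
move/eqP: (ss) => ss'; exists (Tuple ss'); last by exists q.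
by rewrite /= inE; apply/andP; split; [exact/eqP|exact/asboolP].
Qed.

Lemma start_closed c : closed (start c).
Proof. exact: (word_cells_closed gsc). Qed.

Lemma start_in c p : start c p -> K c p.
Proof. by move=> /startP[s [q [_ _ sc Fq ->]]]; apply: sc; exists q. Qed.

Lemma start_F c : start c `<=` F.
Proof. by move=> p /startP[s [q [_ _ _ Fq ->]]]; exact: (F_phis gsc). Qed.

(** Copies of the coloured cells under the powers of the similarity carrying
    the cell [u] to the cell [ur]. *)
Fixpoint grow c n : set (R * R) :=
  if n is n'.+1 then start c `|` phis ur @` (F `&` phis u @^-1` grow c n')
  else start c.

Fixpoint loops n : seq letter := if n is n'.+1 then r ++ loops n' else [::].

(** The cell of u followed by n + 1 copies of r, which is left uncoloured at stage n. *)
Let core n := phis u @` (phis (loops n.+1) @` F).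

Lemma grow_closed c n : closed (grow c n).
Proof.
elim: n => [|n IH]; first exact: start_closed.
apply: closedU; first exact: start_closed.
apply: (phis_closed_image gsc); apply: closed_comp IH => p _.
exact: phis_continuous.
Qed.

Lemma core_closed n : closed (core n).
Proof.
have -> : core n = phis (u ++ loops n.+1) @` (F `&` setT).
  rewrite setIT /core image_comp.
  by apply/seteqP; split => _ [q Fq <-]; exists q; rewrite // phis_cat.
exact/(phis_closed_image gsc)/closedT.
Qed.

Lemma grow_F c n : grow c n `<=` F.
Proof.
case: n => [|n] p; first exact: start_F.
by move=> [/start_F//|[q [Fq _] <-]]; exact: (F_phis gsc).
Qed.

Lemma core_F n : core n `<=` F.
Proof. by move=> _ [_ [q Fq <-] <-]; do 2!apply: (F_phis gsc). Qed.

Lemma grow_sub1 c n : grow c n `<=` grow c n.+1.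
Proof.
elim: n => [|n IH] p; first by left.
by move=> [?|[q [Fq uq] <-]]; [left|right; exists q => //; split => //; exact: IH].
Qed.

Lemma grow_mono c n m : (n <= m)%N -> grow c n `<=` grow c m.
Proof.
move=> /subnK <-; elim: (m - n)%N => [//|k IH]; rewrite addSn.
exact: subset_trans IH (@grow_sub1 _ _).
Qed.

(** By [transfer] the contact is carried back to the cell u and a coloured cell s'; lengthening s'
    by [size r] letters brings it to the level of [ur]. *)
Lemma start_transfer c q : F q -> start c (phis ur q) -> start c (phis u q).
Proof.
move=> Fq /startP[s [p [ss sur sc Fp E]]].
have [s' [ss' su' sc' ->]] := transfer ss sur sc Fp Fq (esym E).
have [t [f [tr Ff ->]]] := F_cover_phis gsc (size r) Fp.
apply/startP; exists (s' ++ t), f; split => //.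
- by rewrite !size_cat ss' tr.
- move=> /eqP; rewrite /ur eqseq_cat ?ss'// => /andP[/eqP /su' []].
- move=> _ [g Fg <-]; rewrite phis_cat; apply: sc'; exists (phis t g) => //.
  exact: (F_phis gsc).
- by rewrite phis_cat.
Qed.

(** When a point of [start] meets the copy inside the cell [ur], [start_transfer] sends it back to
    the previous stage. *)
Lemma grow_disjoint n p : grow true n p -> grow false n p -> False.
Proof.
elim: n p => [|n IH] p; first by move=> /start_in + /start_in; exact: K_disjoint.
have sub c : start c `<=` grow c n by apply: (@grow_mono c 0%N).
move=> [p1|[q [Fq uq] qp]] [p2|[q' [Fq' uq'] qp']].
- by move: p1 p2 => /start_in + /start_in; exact: K_disjoint.
- by rewrite -qp' in p1; apply: (IH _ _ uq'); apply/sub/start_transfer.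
- by rewrite -qp in p2; apply: (IH _ uq); apply/sub/start_transfer.
- by move: qp'; rewrite -qp => /phis_inj E; apply: (IH _ uq); rewrite -E.
Qed.

Lemma grow_cover n p : F p -> [\/ grow true n p, grow false n p | core n p].
Proof.
elim: n p => [|n IH] p Fp; have [s [q [ss Fq pE]]] := F_cover_phis gsc (size ur) Fp;
  (have [sur|sur] := eqVneq s ur; last first).
- have [[] sc] := cell_colour ss (elimN eqP sur).
    by constructor 1; apply/startP; exists s, q; split => //; exact/eqP.
  by constructor 2; apply/startP; exists s, q; split => //; exact/eqP.
- constructor 3; rewrite pE sur /core /= cats0 /ur.
  by exists (phis r q); [exists q|rewrite phis_cat].
- have [[] sc] := cell_colour ss (elimN eqP sur).
    by constructor 1; left; apply/startP; exists s, q; split => //; exact/eqP.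
  by constructor 2; left; apply/startP; exists s, q; split => //; exact/eqP.
- have Fu : F (phis u q) by exact: (F_phis gsc).
  have [H|H|[_ [f Ff <-] /phis_inj qE]] := IH _ Fu.
  + by constructor 1; right; exists q; rewrite -?sur.
  + by constructor 2; right; exists q; rewrite -?sur.
  + constructor 3; exists (phis (loops n.+2) f); first by exists f.
    by rewrite pE sur /ur [RHS]phis_cat -qE; congr (phis u _); exact: phis_cat.
Qed.

Lemma size_loops n : size (loops n) = (n * size r)%N.
Proof. by elim: n => //= n IH; rewrite size_cat IH mulSn. Qed.

(** The cut point has the word u r r r ...; the cores shrink to it while the coloured sets grow over
    the rest of F. *)
Lemma loop_cut_point : exists x, cut_point F x.
Proof.
have [y Fy yE] := phis_fixpoint N2 gsc r_nonempty.
have loop_y n : phis (loops n) y = y.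
  by elim: n => //= n IH; rewrite phis_cat IH.
pose x := phis u y; exists x.
have core_x n : core n x by exists y => //; exists y => //; rewrite loop_y.
have only_x p : (forall n, core n p) -> p = x.
  move=> cp; have [_ [q Fq <-] qp] := cp 0%N; rewrite -qp; congr phis.
  move: (phis _ q) qp => {q Fq} q qp.
  have bound n : exists2 f, F f & q - y = N%:R ^- (n.+1 * size r) *: (f - y).
    have [_ [f Ff <-]] := cp n; rewrite -qp => /phis_inj <-; exists f => //.
    by rewrite -{1}(loop_y n.+1) (phis_dist N2) size_loops.
  have le1 (e a b : R) n : 0 <= a <= 1 -> 0 <= b <= 1 ->
      e = N%:R ^- (n.+1 * size r) * (a - b) -> `|e| * N%:R ^+ n <= 1.
    move=> /andP[a0 a1] /andP[b0 b1] ->; rewrite normrM normfV normrX normr_nat.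
    have N1 := Ngt1 R N2.
    have ab : `|a - b| <= 1 by rewrite ler_norml; apply/andP; split; lra.
    have nn : N%:R ^+ n <= N%:R ^+ (n.+1 * size r) :> R.
      apply: ler_weXn2l; first exact: ltW.
      by rewrite (leq_trans (leqnSn n))// leq_pmulr.
    have Npos : (0 : R) < N%:R ^+ (n.+1 * size r) by rewrite exprn_gt0 ?(lt_trans ltr01).
    rewrite mulrAC; apply: le_trans (_ : N%:R ^- (n.+1 * size r) * N%:R ^+ n <= 1).
      by apply: ler_piMr => //; rewrite mulr_ge0 ?invr_ge0 ?exprn_ge0.
    by rewrite mulrC ler_pdivrMr// mul1r.
  have [f0 Ff0 _] := bound 0%N; have /andP[y1 y2] := F_bounds N2 gsc Fy.
  apply: pair_ext; apply/eqP; rewrite -subr_eq0; apply/eqP;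
    apply: (geometric_eq0 N2) => n; have [f Ff qyE] := bound n;
    have /andP[f1 f2] := F_bounds N2 gsc Ff.
    by apply: le1 f1 y1 _; move/(congr1 fst): qyE.
  by apply: le1 f2 y2 _; move/(congr1 snd): qyE.
(* Adding the core at each stage gives a closed set, which the union of the growing sets need not
   be. *)
pose side c := \bigcap_(n in setT) (grow c n `|` core n).
have grow_side c n p : grow c n p -> side c p.
  move=> gp m _; have [nm|mn] := leqP n m; first by left; exact: grow_mono gp.
  have Fp : F p by exact: grow_F gp.
  case: c gp => gp; have [g|g|g] := grow_cover m Fp; try by [left|right].
    exfalso; apply: grow_disjoint gp _; exact: grow_mono (ltnW mn) _ g.
  exfalso; apply: (grow_disjoint _ gp); exact: grow_mono (ltnW mn) _ g.
have Fx : F x by exact: (F_phis gsc).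
have side_point c : exists p, side c p /\ p <> x.
  have [a aP] := side_cell c; have [f1 [f2 [Ff1 Ff2 f12]]] := F_two_points N2 gsc D2.
  have aside f : F f -> side c (phi (val a) f).
    move=> Ff; have [t [q [ts Fq ->]]] := F_cover_phis gsc (size ur).-1 Ff.
    have [atu atc] := aP t ts; apply: (grow_side c 0%N); apply/startP.
    exists (a :: t), q; split => //=; rewrite ts prednK// size_cat.
    exact: leq_trans r_nonempty (leq_addl _ _).
  have [E|E] := pselect (phi (val a) f1 = x).
    exists (phi (val a) f2); split; first exact: aside.
    by move=> E2; apply: f12; apply: (@phi_inj _ _ (val a)); rewrite E E2.
  by exists (phi (val a) f1); split => //; exact: aside.
apply: (@pair_cut_point _ F x (side true) (side false)); split.
- by apply: closed_bigI => n _; apply: closedU; [exact: grow_closed|exact: core_closed].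
- by apply: closed_bigI => n _; apply: closedU; [exact: grow_closed|exact: core_closed].
- apply/seteqP; split => p.
    by move=> [] /(_ 0%N I) [/grow_F|/core_F].
  move=> Fp; have [[n g]|no1] := pselect (exists n, grow true n p).
    by left; exact: grow_side g.
  have [[n g]|no2] := pselect (exists n, grow false n p).
    by right; exact: grow_side g.
  left=> n _; right; have [g|g|//] := grow_cover n Fp.
    by exfalso; apply: no1; exists n.
  by exfalso; apply: no2; exists n.
- apply/seteqP; split => p.
    move=> [p1 p2]; apply: only_x => n.
    have [g1|//] := p1 n I; have [g2|//] := p2 n I.
    by exfalso; exact: grow_disjoint g1 g2.
  by move=> ->; split => n _; right.
- by split; exact: side_point.
Qed.
End Loop.

Lemma del_component_closed (V : finType) (e : rel V) (v : V) (A : {set V}) :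
  symmetric e -> A \in del_components e v ->
  v \notin A /\ forall w w', w \in A -> w' != v -> e w w' -> w' \in A.
Proof.
move=> e_sym AC; have pE := finset.equivalence_partitionP (del_vertex_connectP (v := v) e_sym).
have nv w : w \in A -> w != v.
  move=> wA; have := finset.cover_partition pE => /setP/(_ w).
  rewrite !inE => <-; apply/bigcupP; by exists A.
split=> [|w w' wA w'v ww']; first by apply/negP => /nv; rewrite eqxx.
have AE : finset.pblock (del_components e v) w = A.
  by apply: finset.def_pblock => //; case/and3P: pE.
rewrite -AE (mem_del_component e_sym (nv _ wA) w'v); apply: connect1.
by apply/and3P; split => //; exact: nv.
Qed.

Lemma del_component_disjoint (V : finType) (e : rel V) (v : V) (A B : {set V}) x :
  symmetric e -> A \in del_components e v -> B \in del_components e v ->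
  A != B -> x \in A -> x \in B -> False.
Proof.
move=> e_sym AC BC AB xA xB.
have pE := finset.equivalence_partitionP (del_vertex_connectP (v := v) e_sym).
have tI : finset.trivIset (del_components e v) by case/and3P: pE.
by case/eqP: AB; rewrite -(finset.def_pblock tI AC xA) (finset.def_pblock tI BC xB).
Qed.

Lemma chi_ge_witness (V : finType) (e : rel V) K : 0 < K -> K <= chi e ->
  exists2 v, cut_vertex e v & K <= nth 0 (component_sizes e v) 1.
Proof.
move=> K0; apply: contraPP => nv; apply/negP; rewrite -ltnNge -(prednK K0) ltnS.
apply/bigmax_leqP => v cv; rewrite -ltnS (prednK K0) ltnNge; apply/negP => Kv.
by apply: nv; exists v.
Qed.

(** A colour and a relative position in [{-1, 0, 1}^2], shifted by [(1, 1)]. *)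
Definition config : finType := {set bool * ('I_3 * 'I_3)}.

(** * Repeated configurations along a cut vertex *)

Section CutVertices.
Local Open Scope classical_set_scope.
Local Open Scope ring_scope.
Variables (R : realType) (N : nat) (D : {set 'I_N * 'I_N}) (F : set (R * R)).
Hypotheses (N2 : (2 <= N)%N) (gsc : is_GSC D F) (Fc : connected F).
Hypothesis (D2 : (1 < #|D|)%N).
Implicit Types (p q : R * R).
Notation letter := {i : 'I_N * 'I_N | i \in D}.
Implicit Types (s t : seq letter).

Section Coloured.
Variables (n : nat) (v : seq letter) (K : bool -> set (R * R)).
Hypotheses (sv : size v = n) (K_closed : forall c, closed (K c)).
Hypothesis K_disjoint : forall p, K true p -> K false p -> False.
Hypothesis K_cover : forall s, size s = n -> s <> v -> exists c, cell_in F K c s.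

(** The cell of s is connected and is covered by subcells of level n other than v, hence by the two
    disjoint closed colours. *)
Lemma prefix_colour s : (size s <= n)%N -> s <> take (size s) v ->
  exists c, cell_in F K c s.
Proof.
move=> sn sv'; have [H|H] : phis s @` F `<=` K true \/ phis s @` F `<=` K false.
- apply: connected_closed_cover; [exact: cell_phis_connected|exact: K_closed|
    exact: K_closed| |].
  - move=> _ [p Fp <-].
    have [t [q [ts Fq ->]]] := F_cover_phis gsc (n - size s) Fp.
    have [||[] H] := K_cover (s := s ++ t).
    + by rewrite size_cat ts subnKC.
    + by move=> E; apply: sv'; rewrite -E take_size_cat.
    + by left; rewrite -phis_cat; apply: H; exists q.
    + by right; rewrite -phis_cat; apply: H; exists q.
  - by apply/seteqP; split => p // [[_ ?] ?]; exact: (K_disjoint (p := p)).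
- by exists true.
- by exists false.
Qed.

(** The record of the colours around the k-th prefix of v; adding 1 brings the offsets -1, 0, 1 into
    ['I_3]. *)
Definition configuration (k : nat) : config :=
  [set z : bool * ('I_3 * 'I_3) | `[< exists s,
    [/\ size s = k, s <> take k v, cell_in F K z.1 s &
        (pos s).1 + 1 = (pos (take k v)).1 + (z.2.1 : nat)%:Z /\
        (pos s).2 + 1 = (pos (take k v)).2 + (z.2.2 : nat)%:Z] >]]%SET.

(** Two cells with a common point have offsets of at most 1, hence recorded. The equal record at k
    yields a cell of the same colour and offset, and by [phisE] equal offsets give equal points. *)
Lemma configuration_transfer k l c s p q : (k <= n)%N -> (l <= n)%N ->
  configuration k = configuration l ->
  size s = l -> s <> take l v -> cell_in F K c s -> F p -> F q ->
  phis s p = phis (take l v) q ->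
  exists s', [/\ size s' = k, s' <> take k v, cell_in F K c s' &
    phis (take k v) q = phis s' p].
Proof.
move=> kn ln cfg ss sl sc Fp Fq; rewrite !(phisE N2).
have N0 j : (N%:R ^- j : R) != 0 by rewrite invr_eq0 expf_neq0// Nneq0.
rewrite ss size_takel ?sv// => -[/(mulfI (N0 _)) E1 /(mulfI (N0 _)) E2].
have /andP[/andP[p1 p1'] /andP[p2 p2']] := F_bounds N2 gsc Fp.
have /andP[/andP[q1 q1'] /andP[q2 q2']] := F_bounds N2 gsc Fq.
have B (i j : int) (a b : R) : 0 <= a -> a <= 1 -> 0 <= b -> b <= 1 ->
    a + i%:~R = b + j%:~R -> exists z : 'I_3, i + 1 = j + (z : nat)%:Z.
  move=> a0 a1 b0 b1 E.
  have h1 : i <= j + 1 by rewrite -(ler_int R) rmorphD /=; lra.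
  have h2 : j <= i + 1 by rewrite -(ler_int R) rmorphD /=; lra.
  have h3 : (absz (i + 1 - j)%R < 3)%N by lia.
  by exists (Ordinal h3) => /=; lia.
have [z1 Z1] := B _ _ _ _ p1 p1' q1 q1' E1; have [z2 Z2] := B _ _ _ _ p2 p2' q2 q2' E2.
have : (c, (z1, z2)) \in configuration l.
  by rewrite inE; apply/asboolP; exists s.
rewrite -cfg inE => /asboolP[s' [ss' sk' sc' /= [Z1' Z2']]].
exists s'; split => //; rewrite !(phisE N2) ss' size_takel ?sv//.
have T (a b : R) (i j i' j' : int) (z : 'I_3) : a + i%:~R = b + j%:~R ->
    i + 1 = j + (z : nat)%:Z -> i' + 1 = j' + (z : nat)%:Z ->
    b + j'%:~R = a + i'%:~R.
  move=> E Z Z'; have W : i - j = i' - j' by lia.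
  have := congr1 (fun m : int => m%:~R : R) W; rewrite !rmorphB /=; lra.
by rewrite (T _ _ _ _ _ _ _ E1 Z1 Z1') (T _ _ _ _ _ _ _ E2 Z2 Z2').
Qed.

Lemma coloured_cut_point : (#|config| < n)%N ->
  (forall c, exists a : letter, [:: a] <> take 1 v /\ cell_in F K c [:: a]) ->
  exists x, cut_point F x.
Proof.
move=> cn heads.
have [k [l [kl ln cfg]]] : exists k l, [/\ (k < l)%N, (l <= n)%N &
    configuration k = configuration l].
  (* Pigeonhole on the n + 1 prefixes of lengths 0 to n. *)
  have : ~~ injectiveb (fun k : 'I_n.+1 => configuration k).
    apply/negP => /injectiveP/leq_card; rewrite card_ord leqNgt => /negP; apply.
    exact: ltnW.
  move=> /injectivePn[k [l kl E]].
  have : (k < l)%N \/ (l < k)%N by apply/orP; rewrite -neq_ltn.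
  case=> kl'; [exists k, l|exists l, k]; split => //; by rewrite -ltnS ltn_ord.
have kn : (k <= n)%N by rewrite (leq_trans (ltnW kl)).
pose u := take k v; pose r := drop k (take l v).
have urE : u ++ r = take l v by rewrite /u /r -(take_takel v (ltnW kl)) cat_take_drop.
have sur : size (u ++ r) = l by rewrite urE size_takel ?sv.
have su : size u = k by rewrite size_takel ?sv.
apply: (@loop_cut_point _ _ _ F N2 gsc D2 K u r K_disjoint).
- move=> s; rewrite sur urE => ss sl; apply: prefix_colour; by rewrite ss.
- move=> c s p q; rewrite sur su urE; exact: configuration_transfer.
- move=> c; have [a [a1 ac]] := heads c; exists a => t ts; split.
    move=> E; apply: a1; have := congr1 (take 1) E.
    by rewrite urE take_takel ?(leq_trans _ kl)//= take0.
  move=> _ [q Fq <-]; apply: ac; exists (phis t q) => //; exact: (F_phis gsc).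
- by rewrite size_drop size_takel ?sv// subn_gt0.
Qed.

End Coloured.

(** One large component is coloured against everything else off v. The sizes serve to find a whole
    first-level cell of each colour. *)
Lemma chi_cut_point n : (#|config| <= n)%N ->
  (#|D| ^ n <= chi (hata_graph D F n.+1))%N -> exists x, cut_point F x.
Proof.
move=> cn.
have K0 : (0 < #|D| ^ n)%N by rewrite expn_gt0 (ltnW D2).
move=> /(chi_ge_witness K0)[v _ /(component_sizes_ge _ _ K0)[A [B [AC BC AB KA KB]]]].
set e := hata_graph D F n.+1 in AC BC.
have e_sym : symmetric e := @hata_sym _ _ _ _ _.
have [vA A_closed] := del_component_closed e_sym AC.
have [vB _] := del_component_closed e_sym BC.
pose X c : {set word D n.+1} := if c then A else (~: A :\ v)%SET.
pose K c : set (R * R) := \bigcup_(w in [set` X c]) (phi_word w @` F).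
have Xv c w : w \in X c -> w != v.
  case: c => [wA|]; first by apply: contraNneq vA => <-.
  by rewrite /X !inE => /andP[].
have K_cell c w : w \in X c -> cell_in F K c w.
  by move=> wX p wp; exists w.
have K_disjoint p : K true p -> K false p -> False.
  move=> [w wA wp] [w' w'A w'p]; have w'v := Xv false _ w'A.
  move: w'A; rewrite /= !inE => /andP[_ /negP]; apply.
  have [<-//|ww'] := eqVneq w w'; apply: A_closed wA w'v _.
  by rewrite /e /hata_graph /= ww'; apply/asboolP; exists p.
have K_closed c : closed (K c) by exact: (word_cells_closed gsc).
have K_cover s : size s = n.+1 -> s <> v -> exists c, cell_in F K c s.
  move=> /eqP ss sv; pose w : word D n.+1 := Tuple ss.
  have wv : w != v by apply/eqP => /(congr1 val).
  have [wA|wA] := boolP (w \in A); [exists true|exists false]; apply: (K_cell _ w) => //.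
  by rewrite /X !inE wv.
have heads c : exists a : letter, [:: a] <> take 1 v /\ cell_in F K c [:: a].
  have [C [CX KC]] : exists C : {set word D n.+1},
      {subset C <= X c} /\ (#|D| ^ n <= #|C|)%N.
    exists (if c then A else B); case: c => //; split => // w wB.
    rewrite !inE; apply/andP; split; first by apply: contraNneq vB => <-.
    by apply/negP => wA; exact: (del_component_disjoint e_sym AC BC AB wA wB).
  have [h [t vE]] := word_consP v.
  have [a [s [aC ah]]] : exists (a : letter) (s : word D n), cons_tuple a s \in C /\ a <> h.
    apply: contrapT => nex.
    (* Besides v, only |D|^n - 1 words share its first letter, too few to fill C. *)
    have sub : C \subset [set cons_tuple h s | s in (~: [set t])%SET]%SET.
      apply/fintype.subsetP => w wC; have [a [s wE]] := word_consP w.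
      have ah : a = h by apply: contrapT => ah; apply: nex; exists a, s; rewrite -wE.
      apply/imsetP; exists s; last by rewrite wE ah.
      rewrite !inE; apply/eqP => st.
      by have := Xv c w (CX w wC); rewrite wE vE ah st eqxx.
    have := leq_trans KC (leq_trans (subset_leq_card sub) (leq_imset_card _ _)).
    by rewrite cardsC1 card_word leqNgt prednK// leqnn.
  have a1 : [:: a] <> take 1 v by rewrite vE /= take0 => -[].
  have [c' c'a] := prefix_colour K_closed K_disjoint K_cover
    (s := [:: a]) isT a1.
  exists a; split => //; suff <- : c' = c by [].
  have [q0 Fq0] : F !=set0 by case: gsc.
  have h1 : K c (phis (a :: s) q0) by apply: (K_cell _ _ (CX _ aC)); exists q0.
  have h2 : K c' (phis (a :: s) q0).
    by apply: c'a; exists (phis s q0) => //; exact: (F_phis gsc).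
  by case: (c) (c') h1 h2 => [] [] // h1 h2; exfalso; [exact: K_disjoint h1 h2|exact: K_disjoint h2 h1].
exact: (coloured_cut_point (size_tuple v) K_closed K_disjoint K_cover _ heads).
Qed.

End CutVertices.

Theorem theorem1p3 (R : realType) :
  exists M : nat, (2 <= M)%N /\
    forall (N : nat) (D : {set 'I_N * 'I_N}) (F : set (R * R)),
      (2 <= N)%N -> (1 < #|D| < N ^ 2)%N ->
      is_GSC D F -> connected F -> ~ fragile D F ->
      ((exists x : R * R, cut_point F x) <->
       (#|D| ^ (M - 1) <= chi (hata_graph D F M))%N).
Proof.
(* There are 2^18 configurations whatever N and D are, fewer than the prefixes of a word of M
   letters. *)
exists #|config|.+1; split.
  by rewrite ltnS; apply/card_gt0P; exists finset.set0.
move=> N D F N2 /andP[D2 _] gsc Fc nf; rewrite subn1 /=; split.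
  by move=> [x]; exact: cut_point_chi.
exact: (chi_cut_point N2 gsc Fc D2 (leqnn _)).
Qed.
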